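(* Let $P$ be a Lie superalgebra over $\mathbb{K}$ and $M$ a $P$-supermodule, considered as an abelian Lie superalgebra (with $P$ acting on $M$ by the supermodule structure, ${}^pm=pm$) and acting trivially on $P$. Then there is an isomorphism of supermodules $$P\otimes M\cong\Omega(P)\otimes_{U(P)}M,$$ where $P\otimes M$ is the non-abelian tensor product, $U(P)$ is the universal enveloping superalgebra of $P$ and $\Omega(P)$ is its augmentation ideal.
   Context: $\mathbb{K}$ is a unital commutative ring. A supermodule is a $\mathbb{K}$-module $M=M_{\bar0}\oplus M_{\bar1}$ graded by $\mathbb{Z}_2$; $|m|$ is the degree of a homogeneous element, and elements occurring in formulas with degrees are homogeneous. A linear map is even if it preserves degrees. A Lie superalgebra is a supermodule $M$ with a bilinear bracket, $[M_{\alpha},M_{\beta}]\subseteq M_{\alpha+\beta}$, such that $[x,y]=-(-1)^{|x||y|}[y,x]$ and $[x,[y,z]]=[[x,y],z]+(-1)^{|x||y|}[y,[x,z]]$ for homogeneous $x,y,z$, and $[x,x]=0$ for $x\in M_{\bar0}$. It is abelian if its bracket is zero. A $P$-supermodule is a supermodule $M$ with an even bilinear map $P\times M\to M$, $(p,m)\mapsto pm$, such that $[p,p']m=p(p'm)-(-1)^{|p||p'|}p'(pm)$; equivalently a $\mathbb{Z}_2$-graded left $U(P)$-module. An action of a Lie superalgebra $P$ on a Lie superalgebra $M$ is an even bilinear map $P\times M\to M$, $(p,m)\mapsto{}^pm$, with ${}^{[p,p']}m={}^p({}^{p'}m)-(-1)^{|p||p'|}\,{}^{p'}({}^pm)$ and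 ${}^p[m,m']=[{}^pm,m']+(-1)^{|p||m|}[m,{}^pm']$; it is trivial if ${}^pm=0$ for all $p,m$. Non-abelian tensor product: for Lie superalgebras $M,N$ acting on each other, $M\otimes N$ is the Lie superalgebra generated by symbols $m\otimes n$ ($m\in M_{\bar0}\cup M_{\bar1}$, $n\in N_{\bar0}\cup N_{\bar1}$), of degree $|m|+|n|$, subject to: (i) $\lambda(m\otimes n)=\lambda m\otimes n=m\otimes\lambda n$ for $\lambda\in\mathbb{K}$; (ii) $(m+m')\otimes n=m\otimes n+m'\otimes n$ and $m\otimes(n+n')=m\otimes n+m\otimes n'$ for $m,m'$ (resp. $n,n'$) of the same degree; (iii) $[m,m']\otimes n=m\otimes{}^{m'}n-(-1)^{|m||m'|}(m'\otimes{}^mn)$ and $m\otimes[n,n']=(-1)^{|n'|(|m|+|n|)}({}^{n'}m\otimes n)-(-1)^{|m||n|}({}^nm\otimes n')$; (iv) $[m\otimes n,m'\otimes n']=-(-1)^{|m||n|}({}^nm\otimes{}^{m'}n')$. $U(P)=T(P)/J(P)$, where $T(P)$ is the tensor algebra of the $\mathbb{K}$-supermodule $P$ with the induced $\mathbb{Z}_2$-grading and $J(P)$ is the two-sided ideal generated by $p\otimes p'-(-1)^{|p||p'|}p'\otimes p-[p,p']$ for homogeneous $p,p'\in P$. $\Omega(P)$ is the kernel of the unique superalgebra homomorphism $\varepsilon\colon U(P)\to\mathbb{K}$ ($\mathbb{K}$ in degree $\bar0$) vanishing on the image of $P$. *)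

(* Defs.v *)
From HB Require Import structures.
From mathcomp Require Import all_boot all_algebra.
From mathcomp Require Import boolp.

Set Implicit Arguments.
Unset Strict Implicit.
Unset Printing Implicit Defensive.

Import GRing.Theory.
Local Open Scope ring_scope.
Local Open Scope quotient_scope.

(* A degree in Z/2 is a bool: [false] is even, [true] is odd, the sum of      *)
(* degrees is [addb] and their product is [andb].  The zero element is        *)
(* homogeneous of both degrees; formulas about homogeneous elements are       *)
(* stated for every element and every degree of which it is homogeneous.      *)

HB.mixin Record isSuperMod (K : comPzRingType) M of GRing.Lmodule K M := {
  homog : bool -> M -> Prop;
  homog0 : forall d, homog d 0;
  homogP : forall d k x y, homog d x -> homog d y -> homog d (k *: x + y);
  homog_split : forall x, exists x0 x1,
    [/\ homog false x0, homog true x1 & x = x0 + x1];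
  homog_cap : forall x, homog false x -> homog true x -> x = 0
}.

#[short(type="superModType")]
HB.structure Definition SuperMod (K : comPzRingType) :=
  {M of GRing.Lmodule K M & isSuperMod K M}.

Notation ksign a b := ((-1) ^+ (nat_of_bool (andb a b))).

HB.mixin Record isLieSuper (K : comPzRingType) L of SuperMod K L := {
  bracket : L -> L -> L;
  bracket_linl : forall y, linear (fun x => bracket x y);
  bracket_linr : forall x, linear (bracket x);
  bracket_homog : forall a b x y,
    homog a x -> homog b y -> homog (a (+) b) (bracket x y);
  bracket_anti : forall a b x y, homog a x -> homog b y ->
    bracket x y = - (ksign a b *: bracket y x);
  bracket_jacobi : forall a b c x y z,
    homog a x -> homog b y -> homog c z ->
    bracket x (bracket y z) =
      bracket (bracket x y) z + ksign a b *: bracket y (bracket x z);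
  bracket_alt : forall x, homog false x -> bracket x x = 0
}.

#[short(type="lieSuperType")]
HB.structure Definition LieSuper (K : comPzRingType) :=
  {L of SuperMod K L & isLieSuper K L}.

Arguments bracket_homog {K s a b x y} _ _.

(* Algebras of the library are nontrivial rings; this structure carries its  *)
(* own product so that the zero ring is allowed, as it is for K.              *)
HB.mixin Record isSuperAlg (K : comPzRingType) A of SuperMod K A := {
  sone : A;
  smul : A -> A -> A;
  smul_linl : forall y, linear (fun x => smul x y);
  smul_linr : forall x, linear (smul x);
  smulA : forall x y z, smul x (smul y z) = smul (smul x y) z;
  smul1l : forall x, smul sone x = x;
  smul1r : forall x, smul x sone = x;
  sone_homog : homog false sone;
  smul_homog : forall a b x y,
    homog a x -> homog b y -> homog (a (+) b) (smul x y)
}.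

#[short(type="superAlgType")]
HB.structure Definition SuperAlg (K : comPzRingType) :=
  {A of SuperMod K A & isSuperAlg K A}.

Section LinearLemmas.
Variables (K : pzRingType) (V W : lmodType K) (f : V -> W).
Hypothesis f_lin : linear f.

Lemma lin0 : f 0 = 0.
Proof.
have := f_lin 1 0 0; rewrite !scale1r addr0 => H.
by apply: (addIr (f 0)); rewrite add0r -H.
Qed.

Lemma linD x y : f (x + y) = f x + f y.
Proof. by have := f_lin 1 x y; rewrite !scale1r. Qed.

Lemma linZ k x : f (k *: x) = k *: f x.
Proof. by have := f_lin k x 0; rewrite lin0 !addr0. Qed.

Lemma linN x : f (- x) = - f x.
Proof. by rewrite -!scaleN1r linZ. Qed.
End LinearLemmas.

Section SuperModTheory.
Variables (K : comPzRingType) (M : superModType K).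
Implicit Types (x y : M) (a d : bool).

Lemma homogD d x y : homog d x -> homog d y -> homog d (x + y).
Proof. by move=> hx hy; rewrite -[x]scale1r; exact: homogP. Qed.

Lemma homogZ d (k : K) x : homog d x -> homog d (k *: x).
Proof.
by move=> hx; rewrite -[_ *: _]addr0; apply: homogP hx _; exact: homog0.
Qed.

Lemma homogN d x : homog d x -> homog d (- x).
Proof. by move=> hx; rewrite -scaleN1r; exact: homogZ. Qed.

Lemma homogB d x y : homog d x -> homog d y -> homog d (x - y).
Proof. by move=> hx hy; apply: homogD hx _; exact: homogN. Qed.

Lemma homog_capb d x : homog d x -> homog (~~ d) x -> x = 0.
Proof. by case: d => /= h1 h2; exact: homog_cap. Qed.

Lemma hproj_ex x : exists p : M * M,
  [/\ homog false p.1, homog true p.2 & x = p.1 + p.2].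
Proof. by have [x0 [x1 ?]] := homog_split x; exists (x0, x1). Qed.

Definition hproj d x : M :=
  if d then (sval (cid (hproj_ex x))).2 else (sval (cid (hproj_ex x))).1.

Lemma hproj_homog d x : homog d (hproj d x).
Proof. by rewrite /hproj; case: cid => p /= []; case: d. Qed.

Lemma hproj_sum x : x = hproj false x + hproj true x.
Proof. by rewrite /hproj; case: cid => p /= []. Qed.

Lemma hproj_unique x x0 x1 : homog false x0 -> homog true x1 ->
  x = x0 + x1 -> forall d, hproj d x = if d then x1 else x0.
Proof.
move=> h0 h1 xE.
have E : hproj false x - x0 = x1 - hproj true x.
  apply/eqP; rewrite subr_eq addrAC [x1 + x0]addrC -xE eq_sym subr_eq.
  by rewrite -hproj_sum.
have F : hproj false x - x0 = 0.
  apply: homog_cap; first exact/homogB/h0/hproj_homog.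
  by rewrite E; apply/homogB/hproj_homog.
case; last by apply/eqP; rewrite -subr_eq0 F.
by apply/esym/eqP; rewrite -subr_eq0 -E F.
Qed.

Lemma hproj_id a d x : homog a x -> hproj d x = if d == a then x else 0.
Proof.
move=> hx; case: a hx => hx.
  by rewrite (hproj_unique (homog0 _) hx (esym (add0r _))); case: d.
by rewrite (hproj_unique hx (homog0 _) (esym (addr0 _))); case: d.
Qed.

Lemma hproj_linear d : linear (hproj d).
Proof.
move=> k x y.
rewrite (@hproj_unique _ (k *: hproj false x + hproj false y)
  (k *: hproj true x + hproj true y)); first by case: d.
- by apply: homogP; exact: hproj_homog.
- by apply: homogP; exact: hproj_homog.
- by rewrite addrACA -scalerDr -!hproj_sum.
Qed.

HB.instance Definition _ d :=
  GRing.isLinear.Build K M M _ (hproj d) (hproj_linear d).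

End SuperModTheory.

Record lieAction (K : comPzRingType) (P M : lieSuperType K) := LieAction {
  lact :> P -> M -> M;
  lact_linl : forall m, linear (fun p => lact p m);
  lact_linr : forall p, linear (lact p);
  lact_homog : forall a b p m,
    homog a p -> homog b m -> homog (a (+) b) (lact p m);
  lact_br : forall a b p p' m, homog a p -> homog b p' ->
    lact (bracket p p') m =
      lact p (lact p' m) - ksign a b *: lact p' (lact p m);
  lact_der : forall a b p m m', homog a p -> homog b m ->
    lact p (bracket m m') =
      bracket (lact p m) m' + ksign a b *: bracket m (lact p m')
}.

Record lieModule (K : comPzRingType) (P : lieSuperType K)
    (M : superModType K) := LieModule {
  lmact :> P -> M -> M;
  lmact_linl : forall m, linear (fun p => lmact p m);
  lmact_linr : forall p, linear (lmact p);
  lmact_homog : forall a b p m,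
    homog a p -> homog b m -> homog (a (+) b) (lmact p m);
  lmact_br : forall a b p p' m, homog a p -> homog b p' ->
    lmact (bracket p p') m =
      lmact p (lmact p' m) - ksign a b *: lmact p' (lmact p m)
}.

Record leftSuperMod (K : comPzRingType) (A : superAlgType K)
    (M : superModType K) := LeftSuperMod {
  lsact :> A -> M -> M;
  lsact_linl : forall m, linear (fun u => lsact u m);
  lsact_linr : forall u, linear (lsact u);
  lsact1 : forall m, lsact sone m = m;
  lsactM : forall u v m, lsact (smul u v) m = lsact u (lsact v m);
  lsact_homog : forall a b u m,
    homog a u -> homog b m -> homog (a (+) b) (lsact u m)
}.

Record rightSuperMod (K : comPzRingType) (A : superAlgType K)
    (M : superModType K) := RightSuperMod {
  rsact :> M -> A -> M;
  rsact_linl : forall u, linear (fun m => rsact m u);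
  rsact_linr : forall m, linear (rsact m);
  rsact1 : forall m, rsact m sone = m;
  rsactM : forall u v m, rsact m (smul u v) = rsact (rsact m u) v;
  rsact_homog : forall a b m u,
    homog a m -> homog b u -> homog (a (+) b) (rsact m u)
}.

Definition abelianLie (K : comPzRingType) (M : superModType K) : Type := M.

Section AbelianLie.
Variables (K : comPzRingType) (M : superModType K).

HB.instance Definition _ := SuperMod.copy (abelianLie M) M.

Let br0 (x y : abelianLie M) : abelianLie M := 0.

Let br0_linl y : linear (fun x => br0 x y).
Proof. by move=> k u v; rewrite /br0 scaler0 addr0. Qed.
Let br0_linr x : linear (br0 x).
Proof. by move=> k u v; rewrite /br0 scaler0 addr0. Qed.
Let br0_homog a b x y : homog a x -> homog b y -> homog (a (+) b) (br0 x y).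
Proof. by move=> _ _; exact: homog0. Qed.
Let br0_anti a b x y : homog a x -> homog b y ->
  br0 x y = - ((ksign a b : K) *: br0 y x).
Proof. by rewrite /br0 scaler0 oppr0. Qed.
Let br0_jacobi a b c x y z :
  homog a x -> homog b y -> homog c z ->
  br0 x (br0 y z) = br0 (br0 x y) z + (ksign a b : K) *: br0 y (br0 x z).
Proof. by rewrite /br0 scaler0 addr0. Qed.
Let br0_alt x : homog false x -> br0 x x = 0.
Proof. by []. Qed.

HB.instance Definition _ := isLieSuper.Build K (abelianLie M)
  br0_linl br0_linr br0_homog br0_anti br0_jacobi br0_alt.

Lemma abelianLieE (x y : abelianLie M) : bracket x y = 0.
Proof. by []. Qed.
End AbelianLie.

Section TrivialAction.
Variables (K : comPzRingType) (P M : lieSuperType K).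

Let tr (p : P) (m : M) : M := 0.
Let tr_linl m : linear (fun p => tr p m).
Proof. by move=> k x y; rewrite /tr scaler0 addr0. Qed.
Let tr_linr p : linear (tr p).
Proof. by move=> k x y; rewrite /tr scaler0 addr0. Qed.
Let tr_homog a b p m : homog a p -> homog b m -> homog (a (+) b) (tr p m).
Proof. by move=> _ _; exact: homog0. Qed.
Let tr_br a b p p' m : homog a p -> homog b p' ->
  tr (bracket p p') m = tr p (tr p' m) - (ksign a b : K) *: tr p' (tr p m).
Proof. by rewrite /tr scaler0 subr0. Qed.
Let tr_der a b p m m' : homog a p -> homog b m ->
  tr p (bracket m m') =
    bracket (tr p m) m' + (ksign a b : K) *: bracket m (tr p m').
Proof.
move=> _ _; rewrite /tr (lin0 (bracket_linl m')) (lin0 (bracket_linr m)).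
by rewrite scaler0 addr0.
Qed.

Definition trivialAction : lieAction P M :=
  LieAction tr_linl tr_linr tr_homog tr_br tr_der.
End TrivialAction.

Section ModuleAction.
Variables (K : comPzRingType) (P : lieSuperType K) (M : superModType K).
Variable rho : lieModule P M.

Let act_der a b (p : P) (m m' : abelianLie M) : homog a p -> homog b m ->
  rho p (bracket m m') =
    bracket (rho p m : abelianLie M) m' +
    (ksign a b : K) *: bracket m (rho p m' : abelianLie M).
Proof.
by move=> _ _; rewrite !abelianLieE (lin0 (lmact_linr rho p)) scaler0 addr0.
Qed.

Definition moduleAction : lieAction P (abelianLie M) :=
  @LieAction K P (abelianLie M) rho (lmact_linl rho) (lmact_linr rho)
    (@lmact_homog _ _ _ rho) (@lmact_br _ _ _ rho) act_der.
End ModuleAction.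

(* K-modules with a family, indexed by [O], of bilinear operations, given by  *)
(* generators and relations.  With one operation these are presentations of   *)
(* (nonassociative) algebras, with none they are presentations of modules.    *)

Section Presentation.
Variables (K : comPzRingType) (O X : Type).

Inductive term : Type :=
| Gen of X
| Zero
| Add of term & term
| Scale of K & term
| Op of O & term & term.

Variable R : term -> term -> Prop.

Inductive tcongr : term -> term -> Prop :=
| tcongr_rel s t : R s t -> tcongr s t
| tcongr_refl t : tcongr t t
| tcongr_sym s t : tcongr s t -> tcongr t s
| tcongr_trans s t u : tcongr s t -> tcongr t u -> tcongr s u
| tcongr_Add s s' t t' : tcongr s s' -> tcongr t t' ->
    tcongr (Add s t) (Add s' t')
| tcongr_Scale k s s' : tcongr s s' -> tcongr (Scale k s) (Scale k s')
| tcongr_Op o s s' t t' : tcongr s s' -> tcongr t t' ->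
    tcongr (Op o s t) (Op o s' t')
| tcongr_addA s t u : tcongr (Add s (Add t u)) (Add (Add s t) u)
| tcongr_addC s t : tcongr (Add s t) (Add t s)
| tcongr_add0 t : tcongr (Add Zero t) t
| tcongr_scaleA k l t : tcongr (Scale k (Scale l t)) (Scale (k * l) t)
| tcongr_scale0 t : tcongr (Scale 0 t) Zero
| tcongr_scale1 t : tcongr (Scale 1 t) t
| tcongr_scaleDr k s t :
    tcongr (Scale k (Add s t)) (Add (Scale k s) (Scale k t))
| tcongr_scaleDl k l t :
    tcongr (Scale (k + l) t) (Add (Scale k t) (Scale l t))
| tcongr_OpDl o s s' t : tcongr (Op o (Add s s') t) (Add (Op o s t) (Op o s' t))
| tcongr_OpDr o s t t' : tcongr (Op o s (Add t t')) (Add (Op o s t) (Op o s t'))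
| tcongr_OpZl o k s t : tcongr (Op o (Scale k s) t) (Scale k (Op o s t))
| tcongr_OpZr o k s t : tcongr (Op o s (Scale k t)) (Scale k (Op o s t)).

HB.instance Definition _ := gen_eqMixin term.
HB.instance Definition _ := gen_choiceMixin term.

Let tcongrb (s t : term) : bool := `[< tcongr s t >].
Let tcongrb_refl : reflexive tcongrb.
Proof. by move=> t; apply/asboolP; constructor. Qed.
Let tcongrb_sym : symmetric tcongrb.
Proof. by move=> s t; apply/asboolP/asboolP; exact: tcongr_sym. Qed.
Let tcongrb_trans : transitive tcongrb.
Proof.
by move=> t s u /asboolP h1 /asboolP h2; apply/asboolP/tcongr_trans/h2.
Qed.

Canonical tcongr_equiv := EquivRel tcongrb tcongrb_refl tcongrb_sym tcongrb_trans.

Definition pres : Type := {eq_quot tcongr_equiv}.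

HB.instance Definition _ := Choice.on pres.

Definition cls (t : term) : pres := \pi_({eq_quot tcongr_equiv}) t.
Definition rep (x : pres) : term := repr (x : {eq_quot tcongr_equiv}).

Lemma repK x : cls (rep x) = x. Proof. exact: reprK. Qed.

Lemma clsP s t : cls s = cls t <-> tcongr s t.
Proof.
by split=> [/eqmodP/asboolP|h]; [|apply/eqmodP/asboolP].
Qed.

Lemma cls_eq s t : tcongr s t -> cls s = cls t. Proof. by move/clsP. Qed.

Lemma rep_cls t : tcongr (rep (cls t)) t. Proof. by apply/clsP/repK. Qed.

Lemma pres_ind (Q : pres -> Prop) : (forall t, Q (cls t)) -> forall x, Q x.
Proof. by move=> h x; rewrite -[x]repK. Qed.

Let padd x y := cls (Add (rep x) (rep y)).
Let pscale k x := cls (Scale k (rep x)).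

Definition pop o x y := cls (Op o (rep x) (rep y)).

Let paddE s t : padd (cls s) (cls t) = cls (Add s t).
Proof. by apply/clsP/tcongr_Add; exact: rep_cls. Qed.
Let pscaleE k s : pscale k (cls s) = cls (Scale k s).
Proof. by apply/clsP/tcongr_Scale/rep_cls. Qed.

Let paddA : associative padd.
Proof.
by do 3![elim/pres_ind=> ?]; rewrite !paddE; apply/clsP; constructor.
Qed.
Let paddC : commutative padd.
Proof. by do 2![elim/pres_ind=> ?]; rewrite !paddE; apply/clsP; constructor. Qed.
Let padd0 : left_id (cls Zero) padd.
Proof. by elim/pres_ind=> ?; rewrite !paddE; apply/clsP; constructor. Qed.

Let pscaleA k l x : pscale k (pscale l x) = pscale (k * l) x.
Proof. by elim/pres_ind: x => ?; rewrite !pscaleE; apply/clsP; constructor. Qed.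
Let pscale0 x : pscale 0 x = cls Zero.
Proof. by elim/pres_ind: x => ?; rewrite !pscaleE; apply/clsP; constructor. Qed.
Let pscale1 : left_id 1 pscale.
Proof. by elim/pres_ind=> ?; rewrite !pscaleE; apply/clsP; constructor. Qed.
Let pscaleDr : right_distributive pscale padd.
Proof.
move=> k; do 2![elim/pres_ind=> ?].
by rewrite ?(paddE, pscaleE); apply/clsP; constructor.
Qed.
Let pscaleDl x : {morph pscale^~ x : k l / k + l >-> padd k l}.
Proof.
move=> k l; elim/pres_ind: x => ?.
by rewrite ?(paddE, pscaleE); apply/clsP; constructor.
Qed.
Let popp x := pscale (- 1) x.
Let paddN : left_inverse (cls Zero) popp padd.
Proof.
by move=> x; rewrite -{2}[x]pscale1 /popp -pscaleDl addNr pscale0.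
Qed.

HB.instance Definition _ := GRing.isZmodule.Build pres paddA paddC padd0 paddN.
HB.instance Definition _ := GRing.Zmodule_isLmodule.Build K pres
  pscaleA pscale1 pscaleDr pscaleDl.

Lemma clsZero : cls Zero = 0. Proof. by []. Qed.
Lemma clsAdd s t : cls (Add s t) = cls s + cls t.
Proof. by rewrite -paddE. Qed.
Lemma clsScale k s : cls (Scale k s) = k *: cls s.
Proof. by rewrite -pscaleE. Qed.
Lemma clsOp o s t : cls (Op o s t) = pop o (cls s) (cls t).
Proof. by apply/clsP/tcongr_sym/tcongr_Op; exact: rep_cls. Qed.

Definition clsE := (clsZero, clsAdd, clsScale, clsOp).

Lemma pop_linl o y : linear (fun x => pop o x y).
Proof.
move=> k x x'; elim/pres_ind: x => x; elim/pres_ind: x' => x'.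
elim/pres_ind: y => y; rewrite -clsScale -clsAdd -!clsOp -clsScale -clsAdd.
apply/clsP.
apply: tcongr_trans (tcongr_OpDl _ _ _ _) _.
by apply: tcongr_Add; [exact: tcongr_OpZl|exact: tcongr_refl].
Qed.

Lemma pop_linr o x : linear (pop o x).
Proof.
move=> k y y'; elim/pres_ind: y => y; elim/pres_ind: y' => y'.
elim/pres_ind: x => x; rewrite -clsScale -clsAdd -!clsOp -clsScale -clsAdd.
apply/clsP.
apply: tcongr_trans (tcongr_OpDr _ _ _ _) _.
by apply: tcongr_Add; [exact: tcongr_OpZr|exact: tcongr_refl].
Qed.

(* [ghom d x] says that the generator [x] is homogeneous of degree [d]; an    *)
(* element of [pres] is homogeneous when it is the class of a homogeneous     *)
(* term.  That this is a grading needs, for every degree, a projection        *)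
(* [gproj] on generators that is compatible with the relations.               *)
Variable ghom : bool -> X -> Prop.

Inductive thom : bool -> term -> Prop :=
| thom_Gen d x : ghom d x -> thom d (Gen x)
| thom_Zero d : thom d Zero
| thom_Add d s t : thom d s -> thom d t -> thom d (Add s t)
| thom_Scale d k t : thom d t -> thom d (Scale k t)
| thom_Op a b o s t : thom a s -> thom b t -> thom (a (+) b) (Op o s t).

Definition phom d (x : pres) : Prop := exists2 t, thom d t & x = cls t.

Variable gproj : bool -> X -> term.

Fixpoint tproj d (t : term) : term :=
  match t with
  | Gen x => gproj d x
  | Zero => Zero
  | Add s t => Add (tproj d s) (tproj d t)
  | Scale k t => Scale k (tproj d t)
  | Op o s t => Add (Op o (tproj false s) (tproj d t))
                    (Op o (tproj true s) (tproj (~~ d) t))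
  end.

Hypothesis gproj_hom : forall d x, thom d (gproj d x).
Hypothesis gproj_sum : forall x,
  cls (Gen x) = cls (gproj false x) + cls (gproj true x).
Hypothesis gproj_id : forall a d x, ghom a x ->
  cls (gproj d x) = if d == a then cls (Gen x) else 0.

Lemma tproj_hom d t : thom d (tproj d t).
Proof.
elim: t d => [x||s hs t ht|k t ht|o s hs t ht] d /=; [exact: gproj_hom| | | |].
- exact: thom_Zero.
- exact: thom_Add.
- exact: thom_Scale.
- apply: thom_Add; first by rewrite -[X in thom X]addFb; exact: thom_Op.
  by rewrite -[X in thom X]negbK -addTb; exact: thom_Op.
Qed.

Lemma tproj_sum t : cls t = cls (tproj false t) + cls (tproj true t).
Proof.
elim: t => [x||s hs t ht|k t ht|o s hs t ht] /=; rewrite ?clsE.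
- exact: gproj_sum.
- by rewrite addr0.
- by rewrite addrACA -hs -ht.
- by rewrite -scalerDr -ht.
- rewrite {1}hs {1}ht (linD (pop_linl _ _)) !(linD (pop_linr _ _)).
  by rewrite [X in _ + X = _]addrC addrACA.
Qed.

Lemma tproj_id a d t : thom a t ->
  cls (tproj d t) = if d == a then cls t else 0.
Proof.
move=> h; elim: h d => {a t} /=.
- by move=> a x hx d; exact: gproj_id.
- by move=> a d; case: ifP.
- by move=> a s t _ hs _ ht d; rewrite !clsE hs ht; case: ifP; rewrite ?addr0.
- by move=> a k t _ ht d; rewrite !clsE ht; case: ifP; rewrite ?scaler0.
- move=> a b o s t _ hs _ ht d; rewrite !clsE !hs !ht.
  have L y : pop o 0 y = 0 by exact: lin0 (pop_linl o y).
  have L' y : pop o y 0 = 0 by exact: lin0 (pop_linr o y).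
  by case: a b d {hs ht} => [] [] [] /=; rewrite ?L ?L' ?addr0 ?add0r.
Qed.

(* A relation between homogeneous terms of the same degree is compatible      *)
(* with the projections.                                                      *)
Lemma tproj_homrel e d s t : thom e s -> thom e t -> R s t ->
  cls (tproj d s) = cls (tproj d t).
Proof.
move=> hs ht rst; rewrite !(@tproj_id e) //.
by case: ifP => // _; apply/clsP/tcongr_rel.
Qed.

Hypothesis tproj_rel : forall d s t, R s t ->
  cls (tproj d s) = cls (tproj d t).

Lemma tproj_congr d s t : tcongr s t -> cls (tproj d s) = cls (tproj d t).
Proof.
move=> h; elim: h d => {s t} /=.
- by move=> s t r d; exact: tproj_rel.
- by [].
- by [].
- by move=> s t u _ h1 _ h2 d; rewrite h1 h2.
- by move=> s s' t t' _ h1 _ h2 d; rewrite !clsE h1 h2.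
- by move=> k s s' _ h d; rewrite !clsE h.
- by move=> o s s' t t' _ h1 _ h2 d; rewrite !clsE !h1 !h2.
- by move=> s t u d; rewrite !clsE addrA.
- by move=> s t d; rewrite !clsE addrC.
- by move=> t d; rewrite !clsE add0r.
- by move=> k l t d; rewrite !clsE scalerA.
- by move=> t d; rewrite !clsE scale0r.
- by move=> t d; rewrite !clsE scale1r.
- by move=> k s t d; rewrite !clsE scalerDr.
- by move=> k l t d; rewrite !clsE scalerDl.
- by move=> o s s' t d; rewrite !clsE !(linD (pop_linl _ _)) addrACA.
- by move=> o s t t' d; rewrite !clsE !(linD (pop_linr _ _)) addrACA.
- by move=> o k s t d; rewrite !clsE !(linZ (pop_linl _ _)) scalerDr.
- by move=> o k s t d; rewrite !clsE !(linZ (pop_linr _ _)) scalerDr.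
Qed.

Lemma phom0 d : phom d 0.
Proof. by exists Zero => //; exact: thom_Zero. Qed.

Lemma phomP d k x y : phom d x -> phom d y -> phom d (k *: x + y).
Proof.
move=> [s hs ->] [t ht ->]; exists (Add (Scale k s) t); last by rewrite !clsE.
by apply: thom_Add => //; exact: thom_Scale.
Qed.

Lemma phom_split x : exists x0 x1, [/\ phom false x0, phom true x1 & x = x0 + x1].
Proof.
elim/pres_ind: x => t; exists (cls (tproj false t)), (cls (tproj true t)).
by split; [eexists; first exact: tproj_hom|eexists; first exact: tproj_hom|
  exact: tproj_sum].
Qed.

Lemma phom_cap x : phom false x -> phom true x -> x = 0.
Proof.
move=> [s hs ->] [t ht /clsP E].
by have := tproj_congr false E; rewrite (tproj_id _ hs) (tproj_id _ ht).
Qed.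

Lemma phom_pop a b o x y : phom a x -> phom b y -> phom (a (+) b) (pop o x y).
Proof.
move=> [s hs ->] [t ht ->]; exists (Op o s t); last by rewrite clsE.
exact: thom_Op.
Qed.

Definition pres_isSuperMod := isSuperMod.Build K pres
  phom0 phomP phom_split phom_cap.

End Presentation.

Arguments Zero {K O X}.
Arguments Gen {K O X} x.
Section Bilinear.
Variables (K : comPzRingType) (L M N : superModType K) (f : L -> M -> N).
Hypothesis f_linl : forall y, linear (fun x => f x y).
Hypothesis f_linr : forall x, linear (f x).
Hypothesis f_homog : forall a b x y,
  homog a x -> homog b y -> homog (a (+) b) (f x y).

Lemma hproj_bilinear d x y : hproj d (f x y) =
  f (hproj false x) (hproj d y) + f (hproj true x) (hproj (~~ d) y).
Proof.
rewrite (@hproj_unique _ _ (f x y)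
  (f (hproj false x) (hproj false y) + f (hproj true x) (hproj true y))
  (f (hproj false x) (hproj true y) + f (hproj true x) (hproj false y)));
  first by case: d.
- apply: homogD; first by apply: (@f_homog false false); exact: hproj_homog.
  by apply: (@f_homog true true); exact: hproj_homog.
- apply: homogD; first by apply: (@f_homog false true); exact: hproj_homog.
  by apply: (@f_homog true false); exact: hproj_homog.
- rewrite [X in f X]hproj_sum [y in LHS]hproj_sum (linD (f_linl _)).
  by rewrite !(linD (f_linr _)) [X in _ + X = _]addrC addrACA.
Qed.
End Bilinear.

Record superIdeal (K : comPzRingType) (A : superAlgType K) := SuperIdeal {
  sideal :> A -> Prop;
  sideal0 : sideal 0;
  sidealD : forall x y, sideal x -> sideal y -> sideal (x + y);
  sidealMl : forall x y, sideal y -> sideal (smul x y);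
  sidealMr : forall x y, sideal x -> sideal (smul x y);
  sideal_hproj : forall d x, sideal x -> sideal (hproj d x)
}.

Section GeneratedIdeal.
Variables (K : comPzRingType) (A : superAlgType K) (S : A -> Prop).

Inductive idealGen : A -> Prop :=
| idealGen_gen x : S x -> idealGen x
| idealGen0 : idealGen 0
| idealGenD x y : idealGen x -> idealGen y -> idealGen (x + y)
| idealGenMl x y : idealGen y -> idealGen (smul x y)
| idealGenMr x y : idealGen x -> idealGen (smul x y).

Hypothesis S_homog : forall x, S x -> exists d, homog d x.

Lemma idealGen_hproj d x : idealGen x -> idealGen (hproj d x).
Proof.
move=> h; elim: h d => {x}.
- move=> x Sx d; have [a hx] := S_homog Sx.
  by rewrite (hproj_id _ hx); case: ifP => _; [exact: idealGen_gen|exact: idealGen0].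
- by move=> d; rewrite linear0; exact: idealGen0.
- by move=> x y _ hx _ hy d; rewrite linearD; exact: idealGenD (hx d) (hy d).
- move=> x y _ hy d.
  rewrite (hproj_bilinear (@smul_linl _ A) (@smul_linr _ A) (@smul_homog _ A)).
  by apply: idealGenD; exact: idealGenMl.
- move=> x y _ hx d.
  rewrite (hproj_bilinear (@smul_linl _ A) (@smul_linr _ A) (@smul_homog _ A)).
  by apply: idealGenD; exact: idealGenMr.
Qed.

Definition generatedIdeal : superIdeal A := SuperIdeal
  idealGen0 idealGenD idealGenMl idealGenMr idealGen_hproj.
End GeneratedIdeal.

Section QuotientAlgebra.
Variables (K : comPzRingType) (A : superAlgType K) (I : superIdeal A).

Lemma sidealZ k x : I x -> I (k *: x).
Proof.
by move=> Ix; rewrite -[x]smul1l -(linZ (smul_linl x)); exact: sidealMl.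
Qed.

Lemma sidealN x : I x -> I (- x).
Proof. by rewrite -scaleN1r; exact: sidealZ. Qed.

Let qrel (x y : A) : bool := `[< I (x - y) >].
Let qrel_refl : reflexive qrel.
Proof. by move=> x; apply/asboolP; rewrite subrr; exact: sideal0. Qed.
Let qrel_sym : symmetric qrel.
Proof. by move=> x y; apply/asboolP/asboolP => /sidealN; rewrite opprB. Qed.
Let qrel_trans : transitive qrel.
Proof.
move=> y x z /asboolP h1 /asboolP h2; apply/asboolP.
by rewrite -(subrKA y); exact: sidealD.
Qed.

Canonical quotAlg_equiv := EquivRel qrel qrel_refl qrel_sym qrel_trans.

Definition quotAlg : Type := {eq_quot quotAlg_equiv}.

HB.instance Definition _ := Choice.on quotAlg.

Definition qcls (x : A) : quotAlg := \pi_({eq_quot quotAlg_equiv}) x.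
Definition qrep (u : quotAlg) : A := repr (u : {eq_quot quotAlg_equiv}).

Lemma qrepK u : qcls (qrep u) = u. Proof. exact: reprK. Qed.

Lemma qclsP x y : qcls x = qcls y <-> I (x - y).
Proof. by split=> [/eqmodP/asboolP|h]; [|apply/eqmodP/asboolP]. Qed.

Lemma qrep_cls x : I (qrep (qcls x) - x).
Proof. by apply/qclsP/qrepK. Qed.

Lemma quotAlg_ind (Q : quotAlg -> Prop) :
  (forall x, Q (qcls x)) -> forall u, Q u.
Proof. by move=> h u; rewrite -[u]qrepK. Qed.

Let qadd u v := qcls (qrep u + qrep v).
Let qopp u := qcls (- qrep u).
Let qscale k u := qcls (k *: qrep u).
Let qmul u v := qcls (smul (qrep u) (qrep v)).

Let qaddE x y : qadd (qcls x) (qcls y) = qcls (x + y).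
Proof.
by apply/qclsP; rewrite opprD addrACA; apply: sidealD; exact: qrep_cls.
Qed.
Let qoppE x : qopp (qcls x) = qcls (- x).
Proof. by apply/qclsP; rewrite -opprD; apply/sidealN/qrep_cls. Qed.
Let qscaleE k x : qscale k (qcls x) = qcls (k *: x).
Proof. by apply/qclsP; rewrite -scalerBr; apply/sidealZ/qrep_cls. Qed.
Let qmulE x y : qmul (qcls x) (qcls y) = qcls (smul x y).
Proof.
apply/qclsP; rewrite -(subrKA (smul x (qrep (qcls y)))); apply: sidealD.
  rewrite -(linN (smul_linl _)) -(linD (smul_linl _)).
  exact/sidealMr/qrep_cls.
rewrite -(linN (smul_linr _)) -(linD (smul_linr _)).
exact/sidealMl/qrep_cls.
Qed.

Let qaddA : associative qadd.
Proof. by do 3![elim/quotAlg_ind=> ?]; rewrite !qaddE addrA. Qed.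
Let qaddC : commutative qadd.
Proof. by do 2![elim/quotAlg_ind=> ?]; rewrite !qaddE addrC. Qed.
Let qadd0 : left_id (qcls 0) qadd.
Proof. by elim/quotAlg_ind=> ?; rewrite !qaddE add0r. Qed.
Let qaddN : left_inverse (qcls 0) qopp qadd.
Proof. by elim/quotAlg_ind=> ?; rewrite qoppE !qaddE addNr. Qed.
Let qscaleA k l u : qscale k (qscale l u) = qscale (k * l) u.
Proof. by elim/quotAlg_ind: u => ?; rewrite !qscaleE scalerA. Qed.
Let qscale1 : left_id 1 qscale.
Proof. by elim/quotAlg_ind=> ?; rewrite !qscaleE scale1r. Qed.
Let qscaleDr : right_distributive qscale qadd.
Proof.
by move=> k; do 2![elim/quotAlg_ind=> ?]; rewrite ?(qaddE, qscaleE) scalerDr.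
Qed.
Let qscaleDl u : {morph qscale^~ u : k l / k + l >-> qadd k l}.
Proof.
by move=> k l; elim/quotAlg_ind: u => ?; rewrite ?(qaddE, qscaleE) scalerDl.
Qed.

HB.instance Definition _ :=
  GRing.isZmodule.Build quotAlg qaddA qaddC qadd0 qaddN.
HB.instance Definition _ := GRing.Zmodule_isLmodule.Build K quotAlg
  qscaleA qscale1 qscaleDr qscaleDl.

Lemma qcls_linear : linear qcls.
Proof. by move=> k x y; rewrite -qaddE -qscaleE. Qed.

Definition quotAlg_homog d (u : quotAlg) : Prop :=
  exists2 x, homog d x & u = qcls x.

Let qhom0 d : quotAlg_homog d 0.
Proof. by exists 0 => //; exact: homog0. Qed.
Let qhomP d k u v : quotAlg_homog d u -> quotAlg_homog d v ->
  quotAlg_homog d (k *: u + v).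
Proof.
move=> [x hx ->] [y hy ->]; exists (k *: x + y); first exact: homogP.
by rewrite qcls_linear.
Qed.
Let qhom_split u : exists u0 u1,
  [/\ quotAlg_homog false u0, quotAlg_homog true u1 & u = u0 + u1].
Proof.
elim/quotAlg_ind: u => x; exists (qcls (hproj false x)), (qcls (hproj true x)).
split; try by eexists; first exact: hproj_homog.
by rewrite -(linD qcls_linear) -hproj_sum.
Qed.
Let qhom_cap u : quotAlg_homog false u -> quotAlg_homog true u -> u = 0.
Proof.
move=> [x hx ->] [y hy /qclsP /(sideal_hproj false)].
rewrite (linD (hproj_linear _)) (linN (hproj_linear _)) (hproj_id _ hx) (hproj_id _ hy) /= subr0 => Ix.
by apply/qclsP; rewrite subr0.
Qed.

HB.instance Definition _ := isSuperMod.Build K quotAlg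
  qhom0 qhomP qhom_split qhom_cap.

Let qmul_linl v : linear (fun u => qmul u v).
Proof.
move=> k u u'; elim/quotAlg_ind: u => x; elim/quotAlg_ind: u' => x'.
elim/quotAlg_ind: v => y; rewrite -qcls_linear !qmulE -qcls_linear.
by rewrite smul_linl.
Qed.
Let qmul_linr u : linear (qmul u).
Proof.
move=> k v v'; elim/quotAlg_ind: v => y; elim/quotAlg_ind: v' => y'.
elim/quotAlg_ind: u => x; rewrite -qcls_linear !qmulE -qcls_linear.
by rewrite smul_linr.
Qed.
Let qmulA u v w : qmul u (qmul v w) = qmul (qmul u v) w.
Proof.
elim/quotAlg_ind: u => x; elim/quotAlg_ind: v => y; elim/quotAlg_ind: w => z.
by rewrite !qmulE smulA.
Qed.
Let qmul1l u : qmul (qcls sone) u = u.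
Proof. by elim/quotAlg_ind: u => x; rewrite qmulE smul1l. Qed.
Let qmul1r u : qmul u (qcls sone) = u.
Proof. by elim/quotAlg_ind: u => x; rewrite qmulE smul1r. Qed.
Let qone_homog : homog false (qcls sone).
Proof. by exists sone => //; exact: sone_homog. Qed.
Let qmul_homog a b u v : homog a u -> homog b v -> homog (a (+) b) (qmul u v).
Proof.
move=> [x hx ->] [y hy ->]; exists (smul x y); first exact: smul_homog.
by rewrite qmulE.
Qed.

HB.instance Definition _ := isSuperAlg.Build K quotAlg
  qmul_linl qmul_linr qmulA qmul1l qmul1r qone_homog qmul_homog.

Lemma qclsM x y : qcls (smul x y) = smul (qcls x) (qcls y).
Proof. by rewrite -qmulE. Qed.

Lemma qcls1 : qcls sone = sone. Proof. by []. Qed.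

Lemma qcls_homog d x : homog d x -> homog d (qcls x).
Proof. by exists x. Qed.
End QuotientAlgebra.

Section TensorAlgebra.
Variables (K : comPzRingType) (P : superModType K).

(* The generator [None] is the unit and [Some p] is the image of [p].         *)
Local Notation tm := (term K unit (option P)).
Local Notation "s ** t" := (Op tt s t) (at level 40, left associativity).

Inductive talg_rel : tm -> tm -> Prop :=
| talg_mulA s t u : talg_rel (s ** (t ** u)) ((s ** t) ** u)
| talg_mul1l t : talg_rel (Gen None ** t) t
| talg_mul1r t : talg_rel (t ** Gen None) t
| talg_linear k p q :
    talg_rel (Gen (Some (k *: p + q))) (Add (Scale k (Gen (Some p))) (Gen (Some q))).

Definition tensorAlg : Type := pres talg_rel.

HB.instance Definition _ := GRing.Lmodule.on tensorAlg.

Definition tinj (p : P) : tensorAlg := cls talg_rel (Gen (Some p)).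

Lemma tinj_linear : linear tinj.
Proof.
by move=> k p q; rewrite /tinj -clsScale -clsAdd; exact/clsP/tcongr_rel/talg_linear.
Qed.

Definition talg_ghom d (x : option P) : Prop :=
  if x is Some p then homog d p else d = false.

Let gproj d (x : option P) : tm :=
  if x is Some p then Gen (Some (hproj d p)) else if d then Zero else Gen None.

Let gproj_hom d x : thom talg_ghom d (gproj d x).
Proof.
case: x => [p|] /=; first by constructor; exact: hproj_homog.
by case: d; constructor.
Qed.
Let gproj_sum x : cls talg_rel (Gen x) =
  cls talg_rel (gproj false x) + cls talg_rel (gproj true x).
Proof.
case: x => [p|] /=; last by rewrite addr0.
by rewrite -!/(tinj _) -(linD tinj_linear) -hproj_sum.
Qed.
Let gproj_id a d x : talg_ghom a x ->
  cls talg_rel (gproj d x) = if d == a then cls talg_rel (Gen x) else 0.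
Proof.
case: x => [p|] /= h; last by rewrite h; case: d.
by rewrite (hproj_id _ h); case: (d == a) => //=; rewrite -/(tinj 0) (lin0 tinj_linear).
Qed.

Let tmulA (x y z : tensorAlg) : pop tt x (pop tt y z) = pop tt (pop tt x y) z.
Proof.
elim/pres_ind: x => x; elim/pres_ind: y => y; elim/pres_ind: z => z.
by rewrite -!clsOp; apply/clsP/tcongr_rel; constructor.
Qed.
Let tmul1l (x : tensorAlg) : pop tt (cls talg_rel (Gen None)) x = x.
Proof.
by elim/pres_ind: x => x; rewrite -clsOp; apply/clsP/tcongr_rel; constructor.
Qed.
Let tmul1r (x : tensorAlg) : pop tt x (cls talg_rel (Gen None)) = x.
Proof.
by elim/pres_ind: x => x; rewrite -clsOp; apply/clsP/tcongr_rel; constructor.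
Qed.

Let gproj_rel d s t : talg_rel s t ->
  cls talg_rel (tproj gproj d s) = cls talg_rel (tproj gproj d t).
Proof.
have L y : pop tt 0 y = 0 :> tensorAlg by exact: lin0 (pop_linl tt y).
have L' y : pop tt y 0 = 0 :> tensorAlg by exact: lin0 (pop_linr tt y).
case=> {s t} /=.
- move=> s t u; rewrite !clsE !(linD (pop_linl tt _)).
  rewrite !(linD (pop_linr tt _)) !tmulA -!addrA; congr (_ + _).
  by rewrite negbK addrA addrC.
- by move=> t; rewrite !clsE L addr0; exact: tmul1l.
- move=> t; rewrite !clsE; case: d => /=; rewrite ?clsE ?L' ?addr0 ?add0r;
  exact: tmul1r.
- move=> k p q; rewrite !clsE -!/(tinj _) hproj_linear; exact: tinj_linear.
Qed.

HB.instance Definition _ : isSuperMod K tensorAlg :=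
  pres_isSuperMod gproj_hom gproj_sum gproj_id gproj_rel.

Let tmul (x y : tensorAlg) : tensorAlg := pop tt x y.
Let tmul_linl y : linear (fun x => tmul x y).
Proof. exact: pop_linl. Qed.
Let tmul_linr x : linear (tmul x).
Proof. exact: pop_linr. Qed.
Let tone_homog : homog false (cls talg_rel (Gen None) : tensorAlg).
Proof. by exists (Gen None) => //; constructor. Qed.
Let tmul_homog a b (x y : tensorAlg) :
  homog a x -> homog b y -> homog (a (+) b) (tmul x y).
Proof. exact: phom_pop. Qed.

HB.instance Definition _ := isSuperAlg.Build K tensorAlg
  tmul_linl tmul_linr tmulA tmul1l tmul1r tone_homog tmul_homog.

Lemma tinj_homog d p : homog d p -> homog d (tinj p).
Proof. by move=> hp; exists (Gen (Some p)) => //; constructor. Qed.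
End TensorAlgebra.

Section Enveloping.
Variables (K : comPzRingType) (P : lieSuperType K).

Inductive env_gen : tensorAlg P -> Prop :=
| EnvGen a b (p p' : P) of homog a p & homog b p' :
    env_gen (smul (tinj p) (tinj p')
             - ksign a b *: smul (tinj p') (tinj p) - tinj (bracket p p')).

Lemma env_gen_homog x : env_gen x -> exists d, homog d x.
Proof.
case=> a b p p' hp hp'; exists (a (+) b).
have h := tinj_homog hp; have h' := tinj_homog hp'.
apply: homogB; last exact/tinj_homog/bracket_homog.
apply: homogB; first exact: smul_homog.
by apply: homogZ; rewrite addbC; exact: smul_homog.
Qed.

Definition envIdeal : superIdeal (tensorAlg P) := generatedIdeal env_gen_homog.

Definition envAlg : Type := quotAlg envIdeal.

HB.instance Definition _ := SuperAlg.on envAlg.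

Definition env_inj (p : P) : envAlg := qcls envIdeal (tinj p).

Fixpoint term_aug (t : term K unit (option P)) : K :=
  match t with
  | Gen (Some _) => 0
  | Gen None => 1
  | Zero => 0
  | Add s t => term_aug s + term_aug t
  | Scale k t => k * term_aug t
  | Op _ s t => term_aug s * term_aug t
  end.

Lemma term_aug_congr s t : tcongr (@talg_rel K P) s t -> term_aug s = term_aug t.
Proof.
elim=> {s t} //=.
- move=> s t; case=> {s t} /=.
  + by move=> s t u; rewrite mulrA.
  + by move=> t; rewrite mul1r.
  + by move=> t; rewrite mulr1.
  + by move=> k p q; rewrite mulr0 addr0.
- by move=> s t u _ -> _ ->.
- by move=> s s' t t' _ -> _ ->.
- by move=> k s s' _ ->.
- by move=> o s s' t t' _ -> _ ->.
- by move=> s t u; rewrite addrA.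
- by move=> s t; rewrite addrC.
- by move=> t; rewrite add0r.
- by move=> k l t; rewrite mulrA.
- by move=> t; rewrite mul0r.
- by move=> t; rewrite mul1r.
- by move=> k s t; rewrite mulrDr.
- by move=> k l t; rewrite mulrDl.
- by move=> o s s' t; rewrite mulrDl.
- by move=> o s t t'; rewrite mulrDr.
- by move=> o k s t; rewrite mulrA.
- by move=> o k s t; rewrite mulrCA.
Qed.

Definition talg_aug (x : tensorAlg P) : K := term_aug (rep x).

Lemma talg_augE t : talg_aug (cls _ t) = term_aug t.
Proof. exact/term_aug_congr/rep_cls. Qed.

Lemma talg_aug_linear k x y : talg_aug (k *: x + y) = k * talg_aug x + talg_aug y.
Proof.
elim/pres_ind: x => s; elim/pres_ind: y => t.
by rewrite -[in LHS]clsScale -[in LHS]clsAdd !talg_augE.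
Qed.

Lemma talg_augM x y : talg_aug (smul x y) = talg_aug x * talg_aug y.
Proof.
elim/pres_ind: x => s; elim/pres_ind: y => t.
by rewrite -[smul _ _]/(pop tt _ _) -clsOp !talg_augE.
Qed.

Lemma talg_aug1 : talg_aug sone = 1. Proof. exact: talg_augE. Qed.

Lemma talg_aug_inj p : talg_aug (tinj p) = 0. Proof. exact: talg_augE. Qed.

Lemma talg_aug_odd x : homog true x -> talg_aug x = 0.
Proof.
move=> [t ht ->]; rewrite talg_augE.
suff H : forall d, thom (@talg_ghom K P) d t -> d -> term_aug t = 0.
  exact: (H true).
move=> d {}ht; elim: ht => {d t x} //=.
- by move=> d [p|] //= ->.
- by move=> d s t _ hs _ ht dT; rewrite hs ?ht ?addr0.
- by move=> d k t _ ht dT; rewrite ht ?mulr0.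
- move=> [] b o s t _ hs _ ht /=; first by rewrite hs ?mul0r.
  by move=> bT; rewrite ht ?mulr0.
Qed.

Lemma talg_aug0 : talg_aug 0 = 0. Proof. exact: talg_augE. Qed.

Lemma talg_aug_ideal x : envIdeal x -> talg_aug x = 0.
Proof.
elim=> {x}.
- move=> _ [a b p p' hp hp']; rewrite addrAC addrC -scaleNr talg_aug_linear.
  rewrite talg_augM talg_aug_inj mul0r mulr0 add0r -scaleN1r addrC.
  by rewrite talg_aug_linear talg_augM !talg_aug_inj mul0r mulr0 addr0.
- exact: talg_aug0.
- move=> x y _ hx _ hy.
  by rewrite -[x]scale1r talg_aug_linear hx hy mulr0 addr0.
- by move=> x y _ hy; rewrite talg_augM hy mulr0.
- by move=> x y _ hx; rewrite talg_augM hx mul0r.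
Qed.

Definition aug (u : envAlg) : K := talg_aug (qrep u).

Lemma augE x : aug (qcls envIdeal x) = talg_aug x.
Proof.
apply/eqP; rewrite -subr_eq0 addrC -mulN1r -talg_aug_linear scaleN1r addrC.
exact/eqP/talg_aug_ideal/qrep_cls.
Qed.

(* [aug] is a homomorphism of superalgebras vanishing on P, and the only one. *)

Lemma aug_linear : linear (aug : envAlg -> K^o).
Proof.
move=> k u v; elim/quotAlg_ind: u => x; elim/quotAlg_ind: v => y.
by rewrite -qcls_linear !augE talg_aug_linear.
Qed.

Lemma augM u v : aug (smul u v) = aug u * aug v.
Proof.
elim/quotAlg_ind: u => x; elim/quotAlg_ind: v => y.
by rewrite -qclsM !augE talg_augM.
Qed.

Lemma aug1 : aug sone = 1.
Proof. by rewrite -qcls1 augE talg_aug1. Qed.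

Lemma aug_env_inj p : aug (env_inj p) = 0.
Proof. by rewrite augE talg_aug_inj. Qed.

Lemma aug_odd u : homog true u -> aug u = 0.
Proof. by move=> [x hx ->]; rewrite augE talg_aug_odd. Qed.

Lemma aug_unique (e : envAlg -> K^o) : linear e ->
  (forall u v, e (smul u v) = e u * e v :> K) -> e sone = 1 ->
  (forall p, e (env_inj p) = 0) -> e =1 aug.
Proof.
move=> e_lin eM e1 eP; elim/quotAlg_ind=> x; rewrite augE.
elim/pres_ind: x => t; rewrite talg_augE.
pose q t : envAlg := qcls envIdeal (cls _ t); rewrite -/(q t).
have qS s k : q (Scale k s) = k *: q s.
  by rewrite /q clsScale (linZ (@qcls_linear _ _ _)).
have qD s s' : q (Add s s') = q s + q s'.
  by rewrite /q clsAdd (linD (@qcls_linear _ _ _)).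
have qM s s' o : q (Op o s s') = smul (q s) (q s').
  by case: o; rewrite /q clsOp -qclsM.
elim: t => [[p|]||s hs t ht|k t ht|o s hs t ht] /=.
- exact: eP.
- exact: e1.
- exact: (lin0 e_lin).
- by rewrite qD (linD e_lin) hs ht.
- by rewrite qS (linZ e_lin) ht.
- by rewrite qM eM hs ht.
Qed.

Definition augker : {pred envAlg} := fun u => aug u == 0.

Lemma augker_submod : GRing.submod_closed augker.
Proof.
split=> [|k u v]; rewrite !unfold_in; first by rewrite (lin0 aug_linear).
by move=> /eqP hu /eqP hv; rewrite aug_linear hu hv scaler0 addr0.
Qed.

HB.instance Definition _ :=
  GRing.isSubmodClosed.Build K envAlg augker augker_submod.

Record augIdeal : Type := AugIdeal { augval : envAlg; _ : augval \in augker }.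

HB.instance Definition _ := [isSub for augval].
HB.instance Definition _ := [Choice of augIdeal by <:].
HB.instance Definition _ := [SubChoice_isSubLmodule of augIdeal by <:].

Lemma aug_val (w : augIdeal) : aug (val w) = 0.
Proof. exact/eqP/(valP w). Qed.

Definition augIdeal_homog d (w : augIdeal) : Prop := homog d (val w).

Let ohom0 d : augIdeal_homog d 0.
Proof. exact: homog0. Qed.
Let ohomP d k x y : augIdeal_homog d x -> augIdeal_homog d y ->
  augIdeal_homog d (k *: x + y).
Proof. exact: homogP. Qed.
Let ohom_split x : exists x0 x1,
  [/\ augIdeal_homog false x0, augIdeal_homog true x1 & x = x0 + x1].
Proof.
have h1 : aug (hproj true (val x)) == 0 by rewrite aug_odd //; exact: hproj_homog.
have h0 : aug (hproj false (val x)) == 0.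
  have := aug_val x; rewrite {1}[val x]hproj_sum (linD aug_linear) (eqP h1).
  by rewrite addr0 => ->.
exists (AugIdeal h0), (AugIdeal h1); split; try exact: hproj_homog.
by apply: val_inj; exact: hproj_sum.
Qed.
Let ohom_cap x : augIdeal_homog false x -> augIdeal_homog true x -> x = 0.
Proof. by move=> h0 h1; apply: val_inj; exact: homog_cap. Qed.

HB.instance Definition _ := isSuperMod.Build K augIdeal
  ohom0 ohomP ohom_split ohom_cap.

Lemma augIdeal_mulr (w : augIdeal) (u : envAlg) : smul (val w) u \in augker.
Proof. by rewrite unfold_in augM aug_val mul0r. Qed.

Let omul w u : augIdeal := AugIdeal (augIdeal_mulr w u).
Let omul_linl u : linear (fun w => omul w u).
Proof. by move=> k w w'; apply: val_inj => /=; rewrite smul_linl. Qed.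
Let omul_linr w : linear (omul w).
Proof. by move=> k u v; apply: val_inj => /=; rewrite smul_linr. Qed.
Let omul1 w : omul w sone = w.
Proof. by apply: val_inj => /=; rewrite smul1r. Qed.
Let omulM u v w : omul w (smul u v) = omul (omul w u) v.
Proof. by apply: val_inj => /=; rewrite smulA. Qed.
Let omul_homog a b w u : homog a w -> homog b u -> homog (a (+) b) (omul w u).
Proof. exact: smul_homog. Qed.

Definition augIdeal_right : rightSuperMod envAlg augIdeal :=
  RightSuperMod omul_linl omul_linr omul1 omulM omul_homog.
End Enveloping.

Section EnvModule.
Variables (K : comPzRingType) (P : lieSuperType K) (M : superModType K).
Variable rho : lieModule P M.

Fixpoint term_act (t : term K unit (option P)) (m : M) : M :=
  match t with
  | Gen (Some p) => rho p m
  | Gen None => m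
  | Zero => 0
  | Add s t => term_act s m + term_act t m
  | Scale k t => k *: term_act t m
  | Op _ s t => term_act s (term_act t m)
  end.

Lemma term_act_linear t : linear (term_act t).
Proof.
elim: t => [[p|]||s hs t ht|l t ht|o s hs t ht] k m m' //=.
- exact: lmact_linr.
- by rewrite scaler0 addr0.
- by rewrite hs ht scalerDr addrACA.
- by rewrite ht scalerDr !scalerA mulrC.
- by rewrite ht hs.
Qed.

Lemma term_act_congr s t m :
  tcongr (@talg_rel K P) s t -> term_act s m = term_act t m.
Proof.
move=> h; elim: h m => {s t} //=.
- by move=> s t; case=> {s t} //= k p q m; exact: lmact_linl.
- by move=> s t u _ h _ h' m; rewrite h h'.
- by move=> s s' t t' _ h _ h' m; rewrite h h'.
- by move=> k s s' _ h m; rewrite h.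
- by move=> o s s' t t' _ h _ h' m; rewrite h h'.
- by move=> s t u m; rewrite addrA.
- by move=> s t m; rewrite addrC.
- by move=> t m; rewrite add0r.
- by move=> k l t m; rewrite scalerA.
- by move=> t m; rewrite scale0r.
- by move=> t m; rewrite scale1r.
- by move=> k s t m; rewrite scalerDr.
- by move=> k l t m; rewrite scalerDl.
- by move=> o s t t' m; rewrite (linD (term_act_linear s)).
- by move=> o k s t m; rewrite (linZ (term_act_linear s)).
Qed.

Definition talg_act (x : tensorAlg P) (m : M) : M := term_act (rep x) m.

Lemma talg_actE t m : talg_act (cls _ t) m = term_act t m.
Proof. exact/term_act_congr/rep_cls. Qed.

Lemma talg_act_linl m : linear (fun x => talg_act x m).
Proof.
move=> k x y; elim/pres_ind: x => s; elim/pres_ind: y => t.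
by rewrite -[in LHS]clsScale -[in LHS]clsAdd !talg_actE.
Qed.

Lemma talg_act_linr x : linear (talg_act x).
Proof. exact: term_act_linear. Qed.

Lemma talg_actM x y m : talg_act (smul x y) m = talg_act x (talg_act y m).
Proof.
elim/pres_ind: x => s; elim/pres_ind: y => t.
by rewrite -[smul _ _]/(pop tt _ _) -clsOp !talg_actE.
Qed.

Lemma talg_act_inj p m : talg_act (tinj p) m = rho p m.
Proof. exact: talg_actE. Qed.

Lemma talg_act_homog a b x m :
  homog a x -> homog b m -> homog (a (+) b) (talg_act x m).
Proof.
move=> [t ht ->] hm; rewrite talg_actE; elim: ht b m hm => {a t x} /=.
- move=> a [p|] /= h b m hm; first exact: lmact_homog.
  by rewrite h.
- by move=> a b m hm; exact: homog0.
- by move=> a s t _ hs _ ht b m hm; apply: homogD; [exact: hs|exact: ht].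
- by move=> a k t _ ht b m hm; apply: homogZ; exact: ht.
- by move=> a a' o s t _ hs _ ht b m hm; rewrite -addbA; apply/hs/ht.
Qed.

Lemma talg_act_ideal x m : envIdeal P x -> talg_act x m = 0.
Proof.
move=> h; elim: h m => {x}.
- move=> _ [a b p p' hp hp'] m.
  rewrite !(linD (talg_act_linl m)) !(linN (talg_act_linl m)).
  rewrite (linZ (talg_act_linl m)) !talg_actM !talg_act_inj.
  by rewrite (lmact_br rho m hp hp') subrr.
- by move=> m; rewrite (lin0 (talg_act_linl m)).
- by move=> x y _ hx _ hy m; rewrite (linD (talg_act_linl m)) hx hy addr0.
- by move=> x y _ hy m; rewrite talg_actM hy (lin0 (talg_act_linr x)).
- by move=> x y _ hx m; rewrite talg_actM hx.
Qed.

Definition env_act (u : envAlg P) (m : M) : M := talg_act (qrep u) m.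

Lemma env_actE x m : env_act (qcls (envIdeal P) x) m = talg_act x m.
Proof.
apply/eqP; rewrite -subr_eq0 -(linN (talg_act_linl m)).
by rewrite -(linD (talg_act_linl m)); apply/eqP/talg_act_ideal/qrep_cls.
Qed.

Let env_act_linl m : linear (fun u => env_act u m).
Proof.
move=> k u v; elim/quotAlg_ind: u => x; elim/quotAlg_ind: v => y.
by rewrite -qcls_linear !env_actE talg_act_linl.
Qed.
Let env_act_linr u : linear (env_act u).
Proof. exact: talg_act_linr. Qed.
Let env_act1 m : env_act sone m = m.
Proof. by rewrite -qcls1 env_actE; exact: talg_actE. Qed.
Let env_actM u v m : env_act (smul u v) m = env_act u (env_act v m).
Proof.
elim/quotAlg_ind: u => x; elim/quotAlg_ind: v => y.
by rewrite -qclsM !env_actE talg_actM.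
Qed.
Let env_act_homog a b u m :
  homog a u -> homog b m -> homog (a (+) b) (env_act u m).
Proof. by move=> [x hx ->] hm; rewrite env_actE; exact: talg_act_homog. Qed.

Definition envModule : leftSuperMod (envAlg P) M :=
  LeftSuperMod env_act_linl env_act_linr env_act1 env_actM env_act_homog.

Lemma envModule_inj p m : envModule (env_inj p) m = rho p m.
Proof. by rewrite /= env_actE talg_act_inj. Qed.
End EnvModule.

Section TensorProduct.
Variables (K : comPzRingType) (A : superAlgType K) (X Y : superModType K).
Variables (xact : rightSuperMod A X) (yact : leftSuperMod A Y).

Local Notation tm := (term K void (X * Y)).

Inductive stensor_rel : tm -> tm -> Prop :=
| stensor_linl k x x' y : stensor_rel (Gen (k *: x + x', y))
    (Add (Scale k (Gen (x, y))) (Gen (x', y)))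
| stensor_linr k x y y' : stensor_rel (Gen (x, k *: y + y'))
    (Add (Scale k (Gen (x, y))) (Gen (x, y')))
| stensor_mid x u y : stensor_rel (Gen (xact x u, y)) (Gen (x, yact u y)).

Definition stensor : Type := pres stensor_rel.

HB.instance Definition _ := GRing.Lmodule.on stensor.

Definition ten (x : X) (y : Y) : stensor := cls stensor_rel (Gen (x, y)).

Lemma ten_linl y : linear (fun x => ten x y).
Proof.
move=> k x x'; rewrite /ten -clsScale -clsAdd.
exact/clsP/tcongr_rel/stensor_linl.
Qed.

Lemma ten_linr x : linear (ten x).
Proof.
move=> k y y'; rewrite /ten -clsScale -clsAdd.
exact/clsP/tcongr_rel/stensor_linr.
Qed.

Lemma ten_mid x u y : ten (xact x u) y = ten x (yact u y).
Proof. exact/clsP/tcongr_rel/stensor_mid. Qed.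

Definition stensor_ghom d (z : X * Y) : Prop :=
  exists a b, [/\ homog a z.1, homog b z.2 & d = a (+) b].

Let gproj d (z : X * Y) : tm :=
  Add (Gen (hproj false z.1, hproj d z.2))
      (Gen (hproj true z.1, hproj (~~ d) z.2)).

Let gproj_hom d z : thom stensor_ghom d (gproj d z).
Proof.
apply: thom_Add; constructor.
  by exists false, d; split=> //; exact: hproj_homog.
by exists true, (~~ d); split; [exact: hproj_homog|exact: hproj_homog|case: d].
Qed.

Let gprojE d x y : cls stensor_rel (gproj d (x, y)) =
  ten (hproj false x) (hproj d y) + ten (hproj true x) (hproj (~~ d) y).
Proof. by rewrite clsE. Qed.

Let gproj_sum z : cls stensor_rel (Gen z) =
  cls stensor_rel (gproj false z) + cls stensor_rel (gproj true z).
Proof.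
case: z => x y; rewrite !gprojE -/(ten x y) [in LHS](hproj_sum x).
rewrite [in LHS](hproj_sum y) (linD (ten_linl _)) !(linD (ten_linr _)).
by rewrite [X in _ + X = _]addrC addrACA.
Qed.

Let gproj_id a d z : stensor_ghom a z ->
  cls stensor_rel (gproj d z) = if d == a then cls stensor_rel (Gen z) else 0.
Proof.
case: z => x y [b [c [/= hx hy ->]]].
rewrite gprojE !(hproj_id _ hx) !(hproj_id _ hy) -/(ten x y).
have L v : ten 0 v = 0 by exact: lin0 (ten_linl v).
have L' v : ten v 0 = 0 by exact: lin0 (ten_linr v).
by case: b c d {hx hy} => [] [] [] /=; rewrite ?L ?L' ?addr0 ?add0r.
Qed.

Let gproj_rel d s t : stensor_rel s t ->
  cls stensor_rel (tproj gproj d s) = cls stensor_rel (tproj gproj d t).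
Proof.
have G x y e : cls stensor_rel (tproj gproj e (Gen (x, y))) =
    ten (hproj false x) (hproj e y) + ten (hproj true x) (hproj (~~ e) y).
  exact: gprojE.
have S k t' : cls stensor_rel (tproj gproj d (Scale k t')) =
    k *: cls stensor_rel (tproj gproj d t') by rewrite /= clsE.
have D t1 t2 : cls stensor_rel (tproj gproj d (Add t1 t2)) =
    cls stensor_rel (tproj gproj d t1) + cls stensor_rel (tproj gproj d t2).
  by rewrite /= clsE.
case=> {s t}.
- move=> k x x' y; rewrite D S !G !hproj_linear !ten_linl scalerDr.
  exact: addrACA.
- move=> k x y y'; rewrite D S !G !hproj_linear !ten_linr scalerDr.
  exact: addrACA.
- move=> x u y; rewrite !G.
  rewrite !(hproj_bilinear (rsact_linl xact) (rsact_linr xact)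
    (@rsact_homog _ _ _ xact)).
  rewrite !(hproj_bilinear (lsact_linl yact) (lsact_linr yact)
    (@lsact_homog _ _ _ yact)).
  rewrite !(linD (ten_linl _)) !(linD (ten_linr _)) !ten_mid negbK /=.
  by rewrite addrACA [X in _ + X = _]addrC; case: d {S D}.
Qed.

HB.instance Definition _ : isSuperMod K stensor :=
  pres_isSuperMod gproj_hom gproj_sum gproj_id gproj_rel.

Lemma ten_homog a b x y : homog a x -> homog b y -> homog (a (+) b) (ten x y).
Proof.
move=> hx hy; exists (Gen (x, y)) => //; constructor.
by exists a, b.
Qed.
End TensorProduct.

Section NonAbelianTensor.
Variables (K : comPzRingType) (M N : lieSuperType K).
Variables (phi : lieAction M N) (psi : lieAction N M).

Inductive nasym : Type :=
| Sym (a b : bool) (m : M) (n : N) of homog a m & homog b n.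

Definition nasym_deg (x : nasym) : bool := let: Sym a b _ _ _ _ := x in a (+) b.

Definition nasym_ghom (d : bool) (x : nasym) : Prop := d = nasym_deg x.

Local Notation tm := (term K unit nasym).
Local Notation "m \ox n" := (Gen (Sym m n)) (at level 40, no associativity).
Local Notation "[[ s , t ]]" := (Op tt s t).
Local Notation homogeneous := (thom nasym_ghom).

(* [hm \ox hn] is the symbol m (x) n, where [hm] and [hn] are proofs that m   *)
(* and n are homogeneous; [phi m n] is the action of m on n and [psi n m] the *)
(* action of n on m.  The first three relations make the quotient a Lie       *)
(* superalgebra.                                                              *)
Inductive natensor_rel : tm -> tm -> Prop :=
| natensor_anti a b s t : homogeneous a s -> homogeneous b t ->
    natensor_rel [[s, t]] (Scale (- ksign a b) [[t, s]])
| natensor_jacobi a b c s t u :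
    homogeneous a s -> homogeneous b t -> homogeneous c u ->
    natensor_rel [[s, [[t, u]]]]
      (Add [[ [[s, t]], u]] (Scale (ksign a b) [[t, [[s, u]]]]))
| natensor_alt s : homogeneous false s -> natensor_rel [[s, s]] Zero
| natensor_Zl a b k (m : M) (n : N) (hm : homog a m) (hn : homog b n) :
    natensor_rel (Scale k (hm \ox hn)) (homogZ k hm \ox hn)
| natensor_Zr a b k (m : M) (n : N) (hm : homog a m) (hn : homog b n) :
    natensor_rel (Scale k (hm \ox hn)) (hm \ox homogZ k hn)
| natensor_Dl a b (m m' : M) (n : N)
    (hm : homog a m) (hm' : homog a m') (hn : homog b n) :
    natensor_rel (homogD hm hm' \ox hn) (Add (hm \ox hn) (hm' \ox hn))
| natensor_Dr a b (m : M) (n n' : N)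
    (hm : homog a m) (hn : homog b n) (hn' : homog b n') :
    natensor_rel (hm \ox homogD hn hn') (Add (hm \ox hn) (hm \ox hn'))
| natensor_brl a a' b (m m' : M) (n : N)
    (hm : homog a m) (hm' : homog a' m') (hn : homog b n) :
    natensor_rel (bracket_homog hm hm' \ox hn)
      (Add (hm \ox lact_homog phi hm' hn)
           (Scale (- ksign a a') (hm' \ox lact_homog phi hm hn)))
| natensor_brr a b b' (m : M) (n n' : N)
    (hm : homog a m) (hn : homog b n) (hn' : homog b' n') :
    natensor_rel (hm \ox bracket_homog hn hn')
      (Add (Scale (ksign b' (a (+) b)) (lact_homog psi hn' hm \ox hn))
           (Scale (- ksign a b) (lact_homog psi hn hm \ox hn')))
| natensor_br a b a' b' (m m' : M) (n n' : N)
    (hm : homog a m) (hn : homog b n) (hm' : homog a' m') (hn' : homog b' n') :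
    natensor_rel [[hm \ox hn, hm' \ox hn']]
      (Scale (- ksign a b) (lact_homog psi hn hm \ox lact_homog phi hm' hn')).

Definition natensor : Type := pres natensor_rel.

HB.instance Definition _ := GRing.Lmodule.on natensor.

Definition nasymb a b (m : M) (n : N) (hm : homog a m) (hn : homog b n) :
  natensor := cls natensor_rel (hm \ox hn).

Let gproj d (x : nasym) : tm := if d == nasym_deg x then Gen x else Zero.

Let gproj_hom d x : homogeneous d (gproj d x).
Proof. by rewrite /gproj; case: eqP => h; constructor. Qed.
Let gproj_sum x : cls natensor_rel (Gen x) =
  cls natensor_rel (gproj false x) + cls natensor_rel (gproj true x).
Proof. by rewrite /gproj; case: nasym_deg => /=; rewrite ?addr0 ?add0r. Qed.
Let gproj_id a d x : nasym_ghom a x ->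
  cls natensor_rel (gproj d x) = if d == a then cls natensor_rel (Gen x) else 0.
Proof. by rewrite /nasym_ghom /gproj => ->; case: ifP. Qed.

Let thom_sym d a b (m : M) (n : N) (hm : homog a m) (hn : homog b n) :
  d = a (+) b -> homogeneous d (hm \ox hn : tm).
Proof. by move=> dE; constructor. Qed.

Let natensor_rel_homog s t : natensor_rel s t ->
  exists2 d, homogeneous d s & homogeneous d t.
Proof.
case=> {s t}.
- move=> a b s t hs ht; exists (a (+) b); first exact: thom_Op.
  by apply: thom_Scale; rewrite addbC; exact: thom_Op.
- move=> a b c s t u hs ht hu; exists (a (+) (b (+) c)).
    by do 2!apply: thom_Op => //.
  apply: thom_Add; first by rewrite addbA; do 2!apply: thom_Op => //.
  by apply: thom_Scale; rewrite addbCA; do 2!apply: thom_Op => //.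
- move=> s hs; exists false; last by constructor.
  exact: (@thom_Op _ _ _ _ false false).
- move=> a b k m n hm hn; exists (a (+) b); last exact: thom_sym.
  by apply: thom_Scale; exact: thom_sym.
- move=> a b k m n hm hn; exists (a (+) b); last exact: thom_sym.
  by apply: thom_Scale; exact: thom_sym.
- move=> a b m m' n hm hm' hn; exists (a (+) b); first exact: thom_sym.
  by apply: thom_Add; exact: thom_sym.
- move=> a b m n n' hm hn hn'; exists (a (+) b); first exact: thom_sym.
  by apply: thom_Add; exact: thom_sym.
- move=> a a' b m m' n hm hm' hn; exists (a (+) a' (+) b); first exact: thom_sym.
  apply: thom_Add; first by apply: thom_sym; rewrite addbA.
  by apply: thom_Scale; apply: thom_sym; rewrite addbCA addbA.
- move=> a b b' m n n' hm hn hn'; exists (a (+) (b (+) b')); first exact: thom_sym.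
  apply: thom_Add; apply: thom_Scale; apply: thom_sym.
    by clear; case: a; case: b; case: b'.
  by clear; case: a; case: b; case: b'.
- move=> a b a' b' m m' n n' hm hn hm' hn'; exists ((a (+) b) (+) (a' (+) b')).
    by apply: thom_Op; exact: thom_sym.
  by apply: thom_Scale; apply: thom_sym; congr (_ (+) _); exact: addbC.
Qed.

Let gproj_rel d s t : natensor_rel s t ->
  cls natensor_rel (tproj gproj d s) = cls natensor_rel (tproj gproj d t).
Proof.
move=> r; have [e hs ht] := natensor_rel_homog r.
exact: (tproj_homrel gproj_id d hs ht r).
Qed.

HB.instance Definition _ : isSuperMod K natensor :=
  pres_isSuperMod gproj_hom gproj_sum gproj_id gproj_rel.

Let nbr (x y : natensor) : natensor := pop tt x y.

Let nbr_linl y : linear (fun x => nbr x y).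
Proof. exact: pop_linl. Qed.
Let nbr_linr x : linear (nbr x).
Proof. exact: pop_linr. Qed.
Let nbr_homog a b (x y : natensor) :
  homog a x -> homog b y -> homog (a (+) b) (nbr x y).
Proof. exact: phom_pop. Qed.
Let nbr_anti a b (x y : natensor) : homog a x -> homog b y ->
  nbr x y = - ((ksign a b : K) *: nbr y x).
Proof.
move=> [s hs ->] [t ht ->]; rewrite -scaleNr /nbr -!clsOp -clsScale.
exact/clsP/tcongr_rel/natensor_anti.
Qed.
Let nbr_jacobi a b c (x y z : natensor) :
  homog a x -> homog b y -> homog c z ->
  nbr x (nbr y z) = nbr (nbr x y) z + (ksign a b : K) *: nbr y (nbr x z).
Proof.
move=> [s hs ->] [t ht ->] [u hu ->].
rewrite /nbr -!clsOp -clsScale -clsAdd.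
exact/clsP/tcongr_rel/(natensor_jacobi hs ht hu).
Qed.
Let nbr_alt (x : natensor) : homog false x -> nbr x x = 0.
Proof.
move=> [s hs ->]; rewrite /nbr -clsOp.
exact/clsP/tcongr_rel/natensor_alt.
Qed.

HB.instance Definition _ := isLieSuper.Build K natensor
  nbr_linl nbr_linr nbr_homog nbr_anti nbr_jacobi nbr_alt.

Lemma nasymb_homog a b (m : M) (n : N) (hm : homog a m) (hn : homog b n) :
  homog (a (+) b) (nasymb hm hn).
Proof. by exists (hm \ox hn) => //; exact: thom_sym. Qed.
End NonAbelianTensor.

Definition superIso (K : comPzRingType) (V W : superModType K) : Prop :=
  exists f : {linear V -> W},
    bijective f /\ forall d x, homog d (f x) <-> homog d x.

(* Main.v *)
(* Since M acts trivially on P, relation (iv) kills all brackets of P (x) M.   *)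
(* Let p act on M (+) (P (x) M) by p(m, x) = (pm, p (x) m).  The first part of *)
(* relation (iii) says exactly that this is a P-supermodule, so U(P) acts on   *)
(* it, and u(0, x) = (0, aug(u) x).  The second component of w(m, 0), for w in *)
(* the augmentation ideal, is therefore U(P)-balanced in (w, m) and induces    *)
(* the inverse of the map p (x) m |-> p (x)_U m.                               *)
Require Import Defs.
From HB Require Import structures.
From mathcomp Require Import all_boot all_algebra.
From mathcomp Require Import boolp.

Set Implicit Arguments.
Unset Strict Implicit.
Unset Printing Implicit Defensive.

Import GRing.Theory.
Local Open Scope ring_scope.

(** [fwd] sends the symbol of p and m to p tensor m over U(P). It exists because brackets can be
    sent to zero and because, once p' is moved across the tensor sign, the first half of relation
    (iii) becomes the defining relation of U(P) ([fwd_rel]). Conversely, the symbols span P (x) M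
    over K ([natensor_ind]), and M (+) (P (x) M) is an extension of M by a module on which U(P) acts
    through [aug]. The second component of u(m, 0) is therefore a cocycle in u. On the augmentation
    ideal it is balanced ([ext_snd_mid]), which gives [bwd]. The map u |-> u - aug(u)1 obeys the
    same product rule ([aug_projM]), so induction on u matches the two cocycles under [fwd]
    ([fwd_extModule]). Hence [bwdK]; [fwdK] is checked on symbols. *)

(** * Linear maps out of a presentation *)

Section LinearExtension.
Variables (K : comPzRingType) (O X : Type) (R : term K O X -> term K O X -> Prop).
Variables (V : lmodType K) (f : X -> V).

(** Operations go to 0: the tensor product over U(P) has none, and in P (x) M all brackets
    vanish. *)
Fixpoint lin_eval (t : term K O X) : V :=
  match t with
  | Gen x => f x
  | Zero => 0
  | Add s t => lin_eval s + lin_eval t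
  | Scale k t => k *: lin_eval t
  | Op _ _ _ => 0
  end.

Hypothesis lin_eval_rel : forall s t, R s t -> lin_eval s = lin_eval t.

Lemma lin_eval_congr s t : tcongr R s t -> lin_eval s = lin_eval t.
Proof.
elim=> {s t} //=.
- by move=> s t u _ -> _ ->.
- by move=> s s' t t' _ -> _ ->.
- by move=> k s s' _ ->.
- by move=> s t u; rewrite addrA.
- by move=> s t; rewrite addrC.
- by move=> t; rewrite add0r.
- by move=> k l t; rewrite scalerA.
- by move=> t; rewrite scale0r.
- by move=> t; rewrite scale1r.
- by move=> k s t; rewrite scalerDr.
- by move=> k l t; rewrite scalerDl.
- by move=> o s s' t; rewrite addr0.
- by move=> o s t t'; rewrite addr0.
- by move=> o k s t; rewrite scaler0.
- by move=> o k s t; rewrite scaler0.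
Qed.

Definition lin_ext (x : pres R) : V := lin_eval (rep x).

Lemma lin_extE t : lin_ext (cls R t) = lin_eval t.
Proof. exact/lin_eval_congr/rep_cls. Qed.

Lemma lin_ext_linear : linear lin_ext.
Proof.
move=> k x y; elim/pres_ind: x => s; elim/pres_ind: y => t.
by rewrite -clsScale -clsAdd !lin_extE.
Qed.
End LinearExtension.

(** * Direct sums and even isomorphisms of supermodules *)

Section ProductSuperMod.
Variables (K : comPzRingType) (V W : superModType K).

Let phomog d (x : V * W) : Prop := homog d x.1 /\ homog d x.2.

Let phomog0 d : phomog d 0.
Proof. by split; exact: homog0. Qed.
Let phomogP d k x y : phomog d x -> phomog d y -> phomog d (k *: x + y).
Proof. by move=> [? ?] [? ?]; split; exact: homogP. Qed.
Let phomog_split x : exists x0 x1,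
  [/\ phomog false x0, phomog true x1 & x = x0 + x1].
Proof.
exists (hproj false x.1, hproj false x.2), (hproj true x.1, hproj true x.2).
split; try by split; exact: hproj_homog.
by case: x => v w; congr pair; exact: hproj_sum.
Qed.
Let phomog_cap x : phomog false x -> phomog true x -> x = 0.
Proof.
by case: x => v w [/= h1 h2] [/= h3 h4]; congr pair; exact: homog_cap.
Qed.

HB.instance Definition _ := isSuperMod.Build K (V * W)%type
  phomog0 phomogP phomog_split phomog_cap.
End ProductSuperMod.

(** Evenness of the inverse is automatic: if [f x] has degree d, the image of the other component of
    x is [f x - f (hproj d x)], which has both degrees, so it is 0 and injectivity applies. *)
Lemma superIso_even (K : comPzRingType) (V W : superModType K) (f : V -> W) :
  linear f -> bijective f -> (forall d x, homog d x -> homog d (f x)) ->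
  superIso V W.
Proof.
move=> f_lin f_bij f_even.
pose F := GRing.isLinear.Build K V W _ f f_lin.
exists (HB.pack_for {linear V -> W} f F); split=> // d x; split; last exact: f_even.
move=> /= hfx; have xE : x = hproj d x + hproj (~~ d) x.
  by case: d {hfx}; [rewrite addrC|]; exact: hproj_sum.
suff <- : hproj d x = x by exact: hproj_homog.
rewrite [RHS]xE; suff -> : hproj (~~ d) x = 0 by rewrite addr0.
apply: (bij_inj f_bij); rewrite (lin0 f_lin).
apply: (@homog_capb _ _ d); last exact/f_even/hproj_homog.
have -> : f (hproj (~~ d) x) = f x - f (hproj d x).
  by rewrite {2}xE (linD f_lin) addrAC subrr add0r.
exact/homogB/f_even/hproj_homog.
Qed.

(** * Generation of U(P) and its retraction onto the augmentation ideal *)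

Section EnvelopingInduction.
Variables (K : comPzRingType) (P : lieSuperType K).

Lemma env_ind (Q : envAlg P -> Prop) :
  Q 0 -> (forall k u v, Q u -> Q v -> Q (k *: u + v)) -> Q sone ->
  (forall u v, Q u -> Q v -> Q (smul u v)) -> (forall p, Q (env_inj p)) ->
  forall u, Q u.
Proof.
move=> Q0 Qlin Q1 QM QP; elim/quotAlg_ind=> x; elim/pres_ind: x.
elim=> [[p|]||s hs t ht|k t ht|[] s hs t ht].
- exact: QP.
- exact: Q1.
- exact: Q0.
- rewrite clsAdd (linD (@qcls_linear _ _ _)) -[X in X + _]scale1r.
  exact: Qlin.
- by rewrite clsScale (linZ (@qcls_linear _ _ _)) -[_ *: _]addr0; exact: Qlin.
- by rewrite clsOp; have := QM _ _ hs ht; rewrite -qclsM.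
Qed.

Lemma aug0 : aug (0 : envAlg P) = 0.
Proof. by have := lin0 (@aug_linear K P). Qed.

Lemma env_inj_linear : linear (@env_inj K P).
Proof. by move=> k p q; rewrite /env_inj tinj_linear qcls_linear. Qed.

Lemma env_inj_homog d (p : P) : homog d p -> homog d (env_inj p).
Proof. by move=> hp; apply/qcls_homog/tinj_homog. Qed.

Lemma env_inj_bracket a b (p p' : P) : homog a p -> homog b p' ->
  env_inj (bracket p p') = smul (env_inj p) (env_inj p')
    - ksign a b *: smul (env_inj p') (env_inj p).
Proof.
move=> hp hp'; rewrite /env_inj -!qclsM -(linZ (@qcls_linear _ _ _)).
rewrite -(linN (@qcls_linear _ _ _)) -(linD (@qcls_linear _ _ _)).
by apply/esym/qclsP/idealGen_gen.
Qed.

Lemma aug_proj_in (u : envAlg P) : u - aug u *: sone \in @augker K P.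
Proof.
rewrite unfold_in addrC -scaleNr aug_linear aug1 /=.
by rewrite -[_ *: _]/(- aug u * 1) mulr1 addNr.
Qed.

Definition aug_proj (u : envAlg P) : augIdeal P := AugIdeal (aug_proj_in u).

Lemma aug_proj_val (w : augIdeal P) : aug_proj (val w) = w.
Proof. by apply: val_inj; rewrite /= aug_val scale0r subr0. Qed.

Lemma aug_proj_linear : linear aug_proj.
Proof.
move=> k u v; apply: val_inj; rewrite /= aug_linear.
by rewrite scalerDl scalerBr scalerA opprD addrACA.
Qed.

(** A Fox-type product rule: uv - aug(u)aug(v)1 = (u - aug(u)1)v + aug(u)(v - aug(v)1). *)
Lemma aug_projM u v :
  aug_proj (smul u v) = augIdeal_right P (aug_proj u) v + aug u *: aug_proj v.
Proof.
apply: val_inj; rewrite /= (linD (smul_linl _)) (linN (smul_linl _)).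
rewrite (linZ (smul_linl _)) smul1l augM scalerBr scalerA addrA subrK.
by [].
Qed.

Definition aug_inj (p : P) : augIdeal P := aug_proj (env_inj p).

Lemma val_aug_inj p : val (aug_inj p) = env_inj p.
Proof. by rewrite /= aug_env_inj scale0r subr0. Qed.

Lemma aug_inj_linear : linear aug_inj.
Proof. by move=> k p q; rewrite /aug_inj env_inj_linear aug_proj_linear. Qed.

Lemma aug_inj_homog d (p : P) : homog d p -> homog d (aug_inj p).
Proof. by move=> /env_inj_homog; rewrite -val_aug_inj. Qed.

Lemma aug_inj_bracket a b (p p' : P) : homog a p -> homog b p' ->
  aug_inj (bracket p p') = augIdeal_right P (aug_inj p) (env_inj p')
    - ksign a b *: augIdeal_right P (aug_inj p') (env_inj p).
Proof.
move=> hp hp'; apply: val_inj.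
by rewrite [LHS]val_aug_inj (env_inj_bracket hp hp') -2!val_aug_inj.
Qed.
End EnvelopingInduction.

(** * Symbols span P (x) M *)

Section TensorOfModule.
Variables (K : comPzRingType) (P : lieSuperType K) (M : superModType K).
Variable rho : lieModule P M.

Local Notation PM :=
  (natensor (moduleAction rho) (trivialAction (abelianLie M) P)).
Local Notation OM := (stensor (augIdeal_right P) (envModule rho)).
Local Notation sym hp hm :=
  (@nasymb K P (abelianLie M) (moduleAction rho)
     (trivialAction (abelianLie M) P) _ _ _ _ hp hm).

Local Notation oten := (ten (augIdeal_right P) (envModule rho)).

(** Symbols carry proofs of homogeneity; proof irrelevance makes them depend on the elements and
    degrees only. *)
Lemma sym_eq a b (p p' : P) (m m' : abelianLie M) (hp : homog a p)
    (hp' : homog a p') (hm : homog b m) (hm' : homog b m') :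
  p = p' -> m = m' -> sym hp hm = sym hp' hm'.
Proof.
move=> pE mE; case: _ / pE hp'; case: _ / mE hm' => hm' hp'.
by rewrite (Prop_irrelevance hp hp') (Prop_irrelevance hm hm').
Qed.

Lemma sym_linl a b k (p p' q : P) (m : abelianLie M) (hp : homog a p)
    (hp' : homog a p') (hq : homog a q) (hm : homog b m) :
  q = k *: p + p' -> sym hq hm = k *: sym hp hm + sym hp' hm.
Proof.
move=> qE; rewrite (sym_eq hq (homogD (homogZ k hp) hp') hm hm qE erefl).
rewrite /nasymb -clsScale.
rewrite (cls_eq (tcongr_rel (natensor_Zl _ _ k hp hm))) -clsAdd.
exact/cls_eq/tcongr_rel/natensor_Dl.
Qed.

Lemma sym_linr a b k (p : P) (m m' n : abelianLie M) (hp : homog a p)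
    (hm : homog b m) (hm' : homog b m') (hn : homog b n) :
  n = k *: m + m' -> sym hp hn = k *: sym hp hm + sym hp hm'.
Proof.
move=> nE; rewrite (sym_eq hp hp hn (homogD (homogZ k hm) hm') erefl nE).
rewrite /nasymb -clsScale.
rewrite (cls_eq (tcongr_rel (natensor_Zr _ _ k hp hm))) -clsAdd.
exact/cls_eq/tcongr_rel/natensor_Dr.
Qed.

Lemma sym0l a b (p : P) (m : abelianLie M) (hp : homog a p) (hm : homog b m) :
  p = 0 -> sym hp hm = 0.
Proof.
move=> p0; have pE : p = 1 *: p + p by rewrite p0 scale1r addr0.
have := sym_linl hp hp hp hm pE; rewrite scale1r => E.
by apply: (addrI (sym hp hm)); rewrite addr0 {3}E.
Qed.

Lemma sym0r a b (p : P) (m : abelianLie M) (hp : homog a p) (hm : homog b m) :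
  m = 0 -> sym hp hm = 0.
Proof.
move=> m0; have mE : m = 1 *: m + m by rewrite m0 scale1r addr0.
have := sym_linr hp hm hm hm mE; rewrite scale1r => E.
by apply: (addrI (sym hp hm)); rewrite addr0 {3}E.
Qed.

Fixpoint drop_op (t : term K unit (nasym P (abelianLie M))) :=
  match t with
  | Add s t => Add (drop_op s) (drop_op t)
  | Scale k t => Scale k (drop_op t)
  | Op _ _ _ => Zero
  | _ => t
  end.

Local Notation nrel :=
  (natensor_rel (moduleAction rho) (trivialAction (abelianLie M) P)).

(** By relation (iv) the bracket is a multiple of a symbol whose first entry is an element of P
    acted on by M, hence 0. *)
Lemma bracket_gen (x y : nasym P (abelianLie M)) :
  pop tt (cls nrel (Gen x)) (cls nrel (Gen y)) = 0.
Proof.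
case: x => a b p m hp hm; case: y => a' b' p' m' hp' hm'.
rewrite -clsOp (cls_eq (tcongr_rel (natensor_br _ _ hp hm hp' hm'))) clsScale.
by rewrite -/(nasymb _ _ _ _) sym0l ?scaler0.
Qed.

Lemma bracket_drop_op s t :
  pop tt (cls nrel (drop_op s)) (cls nrel (drop_op t)) = 0.
Proof.
have L y : pop tt 0 y = 0 :> pres nrel by exact: lin0 (pop_linl tt y).
have L' y : pop tt y 0 = 0 :> pres nrel by exact: lin0 (pop_linr tt y).
elim: s => [x||s hs s' hs'|k s hs|o s _ s' _] /=; rewrite ?clsE ?L //.
- elim: t => [y||t ht t' ht'|k t ht|o t _ t' _] /=; rewrite ?clsE ?L' //.
  + exact: bracket_gen.
  + by rewrite (linD (pop_linr _ _)) ht ht' addr0.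
  + by rewrite (linZ (pop_linr _ _)) ht scaler0.
- by rewrite (linD (pop_linl _ _)) hs hs' addr0.
- by rewrite (linZ (pop_linl _ _)) hs scaler0.
Qed.

Lemma cls_drop_op t : cls nrel t = cls nrel (drop_op t).
Proof.
elim: t => [x||s hs t ht|k t ht|[] s hs t ht] //=; rewrite ?clsE.
- by rewrite hs ht.
- by rewrite ht.
- by rewrite hs ht bracket_drop_op.
Qed.

Lemma natensor_ind (Q : PM -> Prop) :
  Q 0 -> (forall k x y, Q x -> Q y -> Q (k *: x + y)) ->
  (forall a b (p : P) (m : abelianLie M) (hp : homog a p) (hm : homog b m),
     Q (sym hp hm)) ->
  forall x, Q x.
Proof.
move=> Q0 Qlin Qsym; elim/pres_ind=> t; rewrite cls_drop_op.
elim: t => [[a b p m hp hm]||s hs t ht|k t ht|o s _ t _] //=.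
- exact: Qsym.
- by rewrite clsAdd -[X in X + _]scale1r; exact: Qlin.
- by rewrite clsScale -[_ *: _]addr0; exact: Qlin.
Qed.

(** * The map from P (x) M to the tensor product over U(P) *)

Definition fwd_gen (x : nasym P (abelianLie M)) : OM :=
  let: Sym _ _ p m _ _ := x in oten (aug_inj p) m.

Lemma fwd_rel s t : nrel s t -> lin_eval fwd_gen s = lin_eval fwd_gen t.
Proof.
have L y : oten 0 y = 0.
  exact: lin0 (ten_linl _ _ y).
have L' w : oten w 0 = 0.
  exact: lin0 (ten_linr _ _ w).
case=> {s t} /=.
- by move=> *; rewrite scaler0.
- by move=> *; rewrite scaler0 addr0.
- by [].
- by move=> *; rewrite (linZ (@aug_inj_linear _ _)) (linZ (ten_linl _ _ _)).
- by move=> *; rewrite (linZ (ten_linr _ _ _)).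
- by move=> *; rewrite (linD (@aug_inj_linear _ _)) (linD (ten_linl _ _ _)).
- by move=> *; rewrite (linD (ten_linr _ _ _)).
(* Here [p, p'] is a supercommutator in U(P), and [ten_mid] lets its right factors act on m. *)
- move=> a a' b p p' m hp hp' hm; rewrite (aug_inj_bracket hp hp').
  rewrite (linD (ten_linl _ _ _)) (linN (ten_linl _ _ _)).
  by rewrite (linZ (ten_linl _ _ _)) !ten_mid !envModule_inj scaleNr.
(* Both sides vanish: M is abelian and acts trivially on P. *)
- move=> a b b' p m m' hp hm hm'.
  by rewrite abelianLieE !(lin0 (@aug_inj_linear _ _)) !L L' !scaler0 addr0.
- by move=> *; rewrite (lin0 (@aug_inj_linear _ _)) L scaler0.
Qed.

Definition fwd : PM -> OM := lin_ext (R := nrel) fwd_gen.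

Lemma fwd_linear : linear fwd.
Proof. exact: lin_ext_linear fwd_rel. Qed.

Lemma fwd_sym a b (p : P) (m : abelianLie M) (hp : homog a p) (hm : homog b m) :
  fwd (sym hp hm) = oten (aug_inj p) m.
Proof. exact: lin_extE fwd_rel _. Qed.

Lemma fwd_homog d x : homog d x -> homog d (fwd x).
Proof.
move=> [t ht ->]; rewrite /fwd (lin_extE fwd_rel).
elim: ht => {d t x} /=.
- by move=> d [a b p m hp hm] -> /=; apply: ten_homog => //; exact: aug_inj_homog.
- by move=> d; exact: homog0.
- by move=> d s t _ hs _ ht; exact: homogD.
- by move=> d k t _ ht; exact: homogZ.
- by move=> a b o s t _ _ _ _; exact: homog0.
Qed.

(** * The extension of M by P (x) M *)

(** Symbols exist for homogeneous entries only; summing over components gives a bilinear map on all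
    of P and M. *)
Definition pten (p : P) (m : M) : PM :=
  \sum_(a : bool) \sum_(b : bool)
    sym (hproj_homog a p) (hproj_homog b (m : abelianLie M)).

Lemma pten_linl m : linear (fun p => pten p m).
Proof.
move=> k p p'; rewrite /pten scaler_sumr -big_split; apply: eq_bigr => a _.
rewrite scaler_sumr -big_split; apply: eq_bigr => b _.
by apply: sym_linl; exact: hproj_linear.
Qed.

Lemma pten_linr p : linear (pten p).
Proof.
move=> k m m'; rewrite /pten scaler_sumr -big_split; apply: eq_bigr => a _.
rewrite scaler_sumr -big_split; apply: eq_bigr => b _.
by apply: sym_linr; exact: hproj_linear.
Qed.

Lemma ptenE a b (p : P) (m : abelianLie M) (hp : homog a p) (hm : homog b m) :
  pten p m = sym hp hm.
Proof.
rewrite /pten (bigD1 a) //= [X in _ + X]big1 ?addr0; last first.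
  move=> a' /negbTE ne; apply: big1 => b' _.
  by apply: sym0l; rewrite (hproj_id _ hp) ne.
rewrite (bigD1 b) //= [X in _ + X]big1 ?addr0; last first.
  by move=> b' /negbTE ne; apply: sym0r; rewrite (hproj_id _ hm) ne.
by apply: sym_eq; [rewrite (hproj_id _ hp)|rewrite (hproj_id _ hm)]; rewrite eqxx.
Qed.

Lemma pten_homog a b (p : P) (m : M) :
  homog a p -> homog b m -> homog (a (+) b) (pten p m).
Proof. by move=> hp hm; rewrite (ptenE hp hm); exact: nasymb_homog. Qed.

(** This is the first half of relation (iii), extended to inhomogeneous m by additivity. *)
Lemma pten_bracket a b (p p' : P) m : homog a p -> homog b p' ->
  pten (bracket p p') m =
    pten p (rho p' m) - ksign a b *: pten p' (rho p m).
Proof.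
move=> hp hp'.
suff H c (n : M) : homog c n -> pten (bracket p p') n =
    pten p (rho p' n) - ksign a b *: pten p' (rho p n).
  rewrite (hproj_sum m) !(linD (lmact_linr _ _)) !(linD (pten_linr _)).
  rewrite !(H _ _ (hproj_homog _ _)) scalerDr opprD.
  exact: addrACA.
move=> hn; rewrite (ptenE (bracket_homog hp hp') (hn : homog c (n : abelianLie M))).
rewrite (ptenE hp (lact_homog (moduleAction rho) hp' hn)).
rewrite (ptenE hp' (lact_homog (moduleAction rho) hp hn)).
rewrite -scaleNr /nasymb -clsScale -clsAdd.
exact/cls_eq/tcongr_rel/natensor_brl.
Qed.

Let eact (p : P) (e : M * PM) : M * PM := (rho p e.1, pten p e.1).

Let eact_linl e : linear (fun p => eact p e).
Proof. by move=> k p q; congr pair; [exact: lmact_linl|exact: pten_linl]. Qed.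
Let eact_linr p : linear (eact p).
Proof. by move=> k e f; congr pair; [exact: lmact_linr|exact: pten_linr]. Qed.
Let eact_homog a b p e : homog a p -> homog b e -> homog (a (+) b) (eact p e).
Proof.
by move=> hp [hm _]; split; [exact: lmact_homog|exact: pten_homog].
Qed.
Let eact_br a b p p' e : homog a p -> homog b p' ->
  eact (bracket p p') e = eact p (eact p' e) - ksign a b *: eact p' (eact p e).
Proof.
by move=> hp hp'; congr pair; [exact: lmact_br|exact: pten_bracket].
Qed.

Definition extModule : lieModule P (M * PM)%type :=
  LieModule eact_linl eact_linr eact_homog eact_br.

Lemma extModule_fst u e : (envModule extModule u e).1 = envModule rho u e.1.
Proof.
elim/env_ind: u e => [|k u v hu hv||u v hu hv|p] e.
- by rewrite !(lin0 (lsact_linl _ _)).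
- by rewrite !lsact_linl -hu -hv.
- by rewrite !lsact1.
- by rewrite !lsactM hu hv.
- by rewrite !envModule_inj.
Qed.

(** P kills the submodule 0 (+) (P (x) M), so U(P) acts on it through the augmentation. *)
Lemma extModule_snd0 u x : (envModule extModule u (0, x)).2 = aug u *: x.
Proof.
elim/env_ind: u x => [|k u v hu hv||u v hu hv|p] x.
- by rewrite (lin0 (lsact_linl _ _)) aug0 scale0r.
- have -> : aug (k *: u + v) = k * aug u + aug v by exact: aug_linear.
  by rewrite lsact_linl scalerDl -scalerA -hv -hu.
- by rewrite lsact1 aug1 scale1r.
- rewrite lsactM augM -scalerA -hv -hu; congr (_ .2); congr (lsact _ _ _).
  (* The first component of v(0, x) is v0 = 0, so the induction hypothesis for u applies to v(0,
     x). *)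
  rewrite [LHS]surjective_pairing extModule_fst.
  by rewrite (lin0 (lsact_linr (envModule rho) _)).
- by rewrite envModule_inj aug_env_inj scale0r; exact: lin0 (pten_linr p).
Qed.

Lemma extModule_snd u m x :
  (envModule extModule u (m, x)).2
    = (envModule extModule u (m, 0)).2 + aug u *: x.
Proof.
have -> : (m, x) = (m, 0) + (0, x) :> M * PM.
  by congr pair; rewrite ?addr0 ?add0r.
by rewrite (linD (lsact_linr _ _)) -extModule_snd0.
Qed.

(** * The inverse map *)

Definition ext_snd (w : augIdeal P) (m : M) : PM :=
  (envModule extModule (val w) (m, 0)).2.

Lemma ext_snd_linl m : linear (fun w => ext_snd w m).
Proof. by move=> k w w'; rewrite /ext_snd linearP lsact_linl. Qed.

Lemma ext_snd_linr w : linear (ext_snd w).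
Proof.
move=> k m m'; rewrite /ext_snd.
have -> : (k *: m + m', 0) = k *: (m, 0) + (m', 0) :> M * PM.
  by congr pair; last by rewrite -[RHS]/(k *: 0 + 0) scaler0 addr0.
by rewrite lsact_linr.
Qed.

(** If u(m, 0) = (um, y), then applying w adds aug(w)y to the second component of w(um, 0), and
    aug(w) = 0. *)
Lemma ext_snd_mid w u m :
  ext_snd (augIdeal_right P w u) m = ext_snd w (envModule rho u m).
Proof.
rewrite /ext_snd -[val _]/(smul (val w) u) lsactM.
rewrite [X in (lsact _ _ X).2]surjective_pairing extModule_fst.
by rewrite extModule_snd aug_val scale0r addr0.
Qed.

Definition bwd_gen (z : augIdeal P * M) : PM := ext_snd z.1 z.2.

Lemma bwd_rel s t : stensor_rel (augIdeal_right P) (envModule rho) s t ->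
  lin_eval bwd_gen s = lin_eval bwd_gen t.
Proof.
case=> {s t} *; [exact: ext_snd_linl|exact: ext_snd_linr|exact: ext_snd_mid].
Qed.

Definition bwd : OM -> PM :=
  lin_ext (R := stensor_rel (augIdeal_right P) (envModule rho)) bwd_gen.

Lemma bwd_linear : linear bwd.
Proof. exact: lin_ext_linear bwd_rel. Qed.

Lemma bwd_ten w m : bwd (oten w m) = ext_snd w m.
Proof. exact: lin_extE bwd_rel _. Qed.

Lemma fwdK : cancel fwd bwd.
Proof.
move=> x; elim/natensor_ind: x => [|k x y hx hy|a b p m hp hm].
- by rewrite (lin0 fwd_linear) (lin0 bwd_linear).
- by rewrite fwd_linear bwd_linear hx hy.
- by rewrite fwd_sym bwd_ten /ext_snd val_aug_inj envModule_inj /= (ptenE hp hm).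
Qed.

Lemma fwd_pten p m : fwd (pten p m) = oten (aug_inj p) m.
Proof.
have H a b q (n : M) : homog a q -> homog b n ->
    fwd (pten q n) = oten (aug_inj q) n.
  by move=> hq hn; rewrite (ptenE hq hn) fwd_sym.
rewrite (hproj_sum m) (hproj_sum p) (linD (pten_linl _)) !(linD (pten_linr _)).
rewrite !(linD fwd_linear) !(H _ _ _ _ (hproj_homog _ _) (hproj_homog _ _)).
rewrite -!(linD (ten_linr _ _ _)) -(linD (ten_linl _ _ _)).
by rewrite -(linD (@aug_inj_linear _ _)).
Qed.

(** Stated for all of U(P), so that induction on algebra generators is available; [bwdK] uses it for
    u in the augmentation ideal, where [aug_proj] is the identity. *)
Lemma fwd_extModule u m :
  fwd (envModule extModule u (m, 0)).2 = oten (aug_proj u) m.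
Proof.
elim/env_ind: u m => [|k u v hu hv||u v hu hv|p] m.
- rewrite (lin0 (lsact_linl _ _)) (lin0 fwd_linear).
  by rewrite (lin0 (@aug_proj_linear _ _)) (lin0 (ten_linl _ _ _)).
- by rewrite lsact_linl aug_proj_linear /= fwd_linear hu hv ten_linl.
- rewrite lsact1 (lin0 fwd_linear).
  have -> : aug_proj sone = 0 :> augIdeal P.
    by apply: val_inj; rewrite /= aug1 scale1r subrr.
  by rewrite (lin0 (ten_linl _ _ _)).
(* The cocycle rule for the extension turns into [aug_projM] after v is moved across the tensor
   sign. *)
- rewrite lsactM [X in lsact _ _ X]surjective_pairing extModule_snd.
  rewrite extModule_fst (linD fwd_linear) (linZ fwd_linear) hu hv.
  by rewrite aug_projM (linD (ten_linl _ _ _)) (linZ (ten_linl _ _ _)) ten_mid.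
- by rewrite envModule_inj; exact: fwd_pten.
Qed.

Lemma bwdK : cancel bwd fwd.
Proof.
(* The last case is empty, as operations are indexed by [void]. *)
elim/pres_ind; elim=> [[w m]||s hs t ht|k t ht|[]].
- by rewrite -/(oten w m) bwd_ten fwd_extModule aug_proj_val.
- by rewrite clsZero (lin0 bwd_linear) (lin0 fwd_linear).
- by rewrite clsAdd (linD bwd_linear) (linD fwd_linear) hs ht.
- by rewrite clsScale (linZ bwd_linear) (linZ fwd_linear) ht.
Qed.
End TensorOfModule.

Theorem proposition3p6 (K : comPzRingType) (P : lieSuperType K)
    (M : superModType K) (rho : lieModule P M) :
  superIso
    (natensor (moduleAction rho) (trivialAction (abelianLie M) P))
    (stensor (augIdeal_right P) (envModule rho)).
Proof.
apply: (superIso_even (@fwd_linear _ _ _ rho)); last exact: fwd_homog.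
exact: Bijective (@fwdK _ _ _ rho) (@bwdK _ _ _ rho).
Qed.
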